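(* Let $c\in(1,9/8)$, and for a positive integer $\lambda$ let \[ r_c(\lambda):=\#\{x\in\mathbb Z^3:\lfloor|x_1|^c\rfloor+\lfloor|x_2|^c\rfloor+\lfloor|x_3|^c\rfloor=\lambda\}. \] Then for every $\varepsilon>0$ we have \[ r_c(\lambda)=\frac{2^3\,\Gamma(1+1/c)^3}{\Gamma(3/c)}\,\lambda^{3/c-1}+O_\varepsilon\big(\lambda^{3/c-1-(9-8c)/(5c)+\varepsilon}\big),\qquad \lambda\in\{1,2,3,\dots\}. \]
   Context: $\Gamma$ is the Gamma function. The implied constant in $O_\varepsilon$ may depend on $\varepsilon$ and $c$ but not on $\lambda$. *)

(* Defs.v *)
From HB Require Import structures.
From mathcomp Require Import all_boot all_order all_algebra.
From mathcomp Require Import finmap.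
From mathcomp Require Import all_classical all_reals all_analysis.

Set Implicit Arguments.
Unset Strict Implicit.
Unset Printing Implicit Defensive.

Import Order.TTheory GRing.Theory Num.Theory.

Local Open Scope classical_set_scope.
Local Open Scope ring_scope.

(* Euler's integral; it converges exactly for s > 0, and Rintegral returns the
   junk value 0 otherwise. *)
Definition Gamma (R : realType) (s : R) : R :=
  \int[lebesgue_measure]_(t in `]0, +oo[) (t `^ (s - 1) * expR (- t)).

Definition floor_pow (R : realType) (c : R) (x : int) : int :=
  Num.floor (`|x|%:~R `^ c : R).

Definition rep_set (R : realType) (c : R) (lambda : nat) :
    set (int * int * int) :=
  [set x | floor_pow c x.1.1 + floor_pow c x.1.2 + floor_pow c x.2
           = lambda%:Z].

(* fset_set sends infinite sets to the empty set; this is harmless when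
   1 <= c, since the set is then finite (rep_set_finite). *)
Definition rep_count (R : realType) (c : R) (lambda : nat) : nat :=
  #|` fset_set (rep_set c lambda)|.

Lemma floor_pow_ge0 (R : realType) (c : R) (x : int) : 0 <= floor_pow c x.
Proof. by rewrite /floor_pow floor_ge0 powR_ge0. Qed.

Lemma floor_pow_ge (R : realType) (c : R) (x : int) :
  1 <= c -> `|x| <= floor_pow c x.
Proof.
move=> c1; rewrite /floor_pow floor_ge_int.
have [->|x0] := eqVneq x 0; first by rewrite normr0 powR_ge0.
rewrite -[leLHS]powRr1 ?ler0z ?normr_ge0//.
apply: ler_powR => //.
by rewrite -[leLHS]/(1%:~R) ler_int -gtz0_ge1 normr_gt0.
Qed.

Lemma rep_set_finite (R : realType) (c : R) (lambda : nat) :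
  1 <= c -> finite_set (rep_set c lambda).
Proof.
move=> c1.
pose s : seq int :=
  [seq Posz n | n <- iota 0 lambda.+1] ++
  [seq - Posz n | n <- iota 0 lambda.+1].
have sP (x : int) : `|x| <= lambda%:Z -> x \in s.
  move=> xl; rewrite mem_cat; apply/orP.
  have xm : `|x|%N \in iota 0 lambda.+1 by rewrite mem_iota/= add0n ltnS -lez_nat abszE.
  have [x0|x0] := leP 0 x; [left|right]; apply/mapP; exists `|x|%N => //.
    by rewrite abszE ger0_norm.
  by rewrite abszE ltr0_norm// opprK.
apply: (@sub_finite_set _ _ [set` allpairs pair (allpairs pair s s) s]);
  last exact: finite_seq.
move=> [[a b] d]; rewrite /rep_set /mkset /= -/s => e.
have [a0 b0 d0] := And3 (floor_pow_ge0 c a) (floor_pow_ge0 c b)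
  (floor_pow_ge0 c d).
have [sa sb sd] : [/\ a \in s, b \in s & d \in s].
  split; apply: sP; rewrite -e.
  - by rewrite (le_trans (floor_pow_ge a c1))// -addrA lerDl addr_ge0.
  - by rewrite (le_trans (floor_pow_ge b c1))// addrAC lerDr addr_ge0.
  - by rewrite (le_trans (floor_pow_ge d c1))// lerDr addr_ge0.
have : (a, b, d) \in allpairs pair (allpairs pair s s) s.
  by apply/allpairsP; exists ((a, b), d); split=> //; apply/allpairsP; exists (a, b).
exact.
Qed.

(* Main.v *)
Require Import Defs.
From HB Require Import structures.
From mathcomp Require Import all_boot all_order all_algebra.
From mathcomp Require Import finmap.
From mathcomp Require Import all_classical all_reals all_analysis.
From mathcomp Require Import measurable_realfun.
From mathcomp Require Import ring lra zify.
Set Implicit Arguments.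
Unset Strict Implicit.
Unset Printing Implicit Defensive.
Import Order.TTheory GRing.Theory Num.Theory.
Import numFieldNormedType.Exports.
Local Open Scope ring_scope.

(** Write g = 1/c, so that 8/9 < g < 1, and let F m be the number of integers x
    with floor (|x|^c) = m.  Then r_c(lambda) is the value at lambda of the
    triple convolution F * F * F.  Counting with ceilings, F m equals
    2 (ceil ((m+1)^g) - ceil (m^g)) except at m = 0; on average this is
    2 ((m+1)^g - m^g), which is about 2 g m^(g-1).

    The smooth model for F is G m = 2 Gamma(1+g) b_g(m), where b_s(m) is the
    coefficient of z^m in (1 - z)^(-s).  It has the right size because
    b_g(m) = Gamma(m+g) / (Gamma(g) m!) is about m^(g-1) / Gamma(g), and its
    triple convolution needs no Beta integral: by the Vandermonde identity
    ([binc_vandermonde]) G * G * G = 8 Gamma(1+g)^3 b_{3g}, which is the main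
    term of the theorem up to O(lambda^(3g-2)) ([binc_asymptotic]).  The only
    analytic facts needed about Gamma are its functional equation and the
    inequality Gamma(x+s) <= x^s Gamma(x) for 0 <= s <= 1
    ([gamma_like_Gamma]).

    With E = F - G, the difference F*F*F - G*G*G is the sum of E*F*F, E*F*G and
    E*G*G.  Orthogonality of the additive characters modulo 2 lambda + 1 and
    Parseval bound the value of E*U*V at lambda by
    sup |sum_m E m cos (2 pi (alpha m + phi))| times the sum of the squared
    l^2 norms of U and V ([conv3_bound]); both norms are O(lambda^(g/2)).
    No separation into major and minor arcs takes place: the frequencies near 0
    are handled by the same estimate, because E already has its mean removed.

    It remains to bound the twisted sums of E uniformly in alpha and phi
    ([twisted_fibre_sum]).  Up to an absolutely summable error, E m is twice the
    increment at m of the sequence ceil (m^g) - m^g, so a summation by parts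
    leaves sums of the sawtooth ceil (m^g) - m^g - 1/2 against
    cos (2 pi (alpha m + phi)).  The sawtooth is replaced by its Fourier series
    truncated at H; the truncation error at y is O(min(1, 1 / (H ||y||))), which
    is majorised by an average of Fejer kernels ([sawtooth_tail_majorant]).
    Everything is thereby reduced to the sums of cos (2 pi (h m^g + a m + p))
    with 0 < h <= H, and the second derivative test ([powR_phase_sum]), a
    consequence of the Kusmin-Landau inequality, bounds them by
    O(sqrt h lambda^(1-g/2)) uniformly in a and p.  With H about lambda^(g/3)
    the twisted sums are O(lambda^(1-g/4)), and 1 - g/4 <= (g+3)/5 holds exactly
    when g >= 8/9.  Multiplication by lambda^g then gives the exponent
    3g - 1 - (9g-8)/5 of the theorem.

    All exponential sums are written with real cosines and an arbitrary phase,
    which takes the place of complex exponentials. *)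

(** * Elementary inequalities *)

Section Elementary.
Variable R : realType.
Implicit Types x y s t u g : R.

Lemma le_of_eq x y : x = y -> x <= y.
Proof. by move=> ->. Qed.

(** Halving the angle, sin x = 2 sin (x/2) cos (x/2), and sin (x/2) = (x/2) cos z
    for some z in between, so sin x >= x cos^2 (x/2) >= x / 2. *)
Lemma sin_ge_half x : 0 <= x <= pi / 2 -> x / 2 <= sin x.
Proof.
move=> /andP[x0 xpi].
have pi2 := pihalf_lt2 R.
have [->|xn0] := eqVneq x 0; first by rewrite sin0 mul0r.
have xp : 0 < x by rewrite lt0r xn0.
pose y := x / 2.
have [z zI szE] := @MVT R sin cos 0 y ltac:(rewrite /y; lra)
  (fun z _ => is_derive_sin z) (continuous_subspaceT (@continuous_sin R)).
move: szE; rewrite sin0 !subr0 => szE.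
move: zI; rewrite in_itv/= => /andP[z0 zy].
have cy : 0 < cos y by apply: cos_gt0_pihalf; rewrite /y; lra.
have yp : 0 < y by rewrite /y; lra.
have cyz : cos y <= cos z.
  apply/ltW; rewrite ltr_cos//; rewrite in_itv/=; have := pi_gt0 R;
  move: z0 zy; rewrite /y; lra.
have c2 : 1 / 2 <= cos y ^+ 2.
  have : 0 <= cos (y *+ 2).
    by apply: cos_ge0_pihalf; rewrite /y; lra.
  rewrite cos_mulr2n; lra.
have -> : x = y *+ 2 by rewrite /y; lra.
rewrite sin_mulr2n szE.
have : cos y * cos y <= cos y * cos z by rewrite ler_pM2l.
rewrite -expr2 => h; have : 1/2 <= cos y * cos z by lra.
move=> h2; have : 1/2*y <= cos y * cos z * y by rewrite ler_pM2r.
lra.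
Qed.

(** Concavity of the power function, in the form of the weighted inequality
    between arithmetic and geometric means of x and 1; it follows from
    ln z <= z - 1 at z = x/w and z = 1/w, where w is the right-hand side. *)
Lemma powR_tangent x s : 0 <= x -> 0 <= s <= 1 -> x `^ s <= 1 + s * (x - 1).
Proof.
move=> x0 /andP[s0 s1].
have [->|xn0] := eqVneq x 0.
  have [->|sn0] := eqVneq s 0; first by rewrite powRr0; lra.
  by rewrite powR0//; lra.
have xp : 0 < x by rewrite lt0r xn0.
have w0 : 0 < 1 + s * (x - 1).
  have [->|sn1] := eqVneq s 1; first by lra.
  have s1' : s < 1 by rewrite lt_neqAle sn1.
  have : 0 <= s * x by rewrite mulr_ge0.
  by lra.
set w := 1 + _ in w0 *.
rewrite /powR (negPf xn0).
rewrite -[leRHS](@lnK R)// ler_expR.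
have lnle (z : R) : 0 < z -> ln z <= z - 1.
  move=> z0; have := @le_ln1Dx R (z - 1) ltac:(lra).
  by rewrite (_ : 1 + (z - 1) = z); [|lra].
have h1 := lnle (x / w) (divr_gt0 xp w0).
have h2 := lnle (w^-1) ltac:(by rewrite invr_gt0).
move: h1 h2; rewrite ln_div// lnV// => h1 h2.
have : s * (ln x - ln w) + (1 - s) * (- ln w) <= s * (x / w - 1) + (1 - s)
  * (w^-1 - 1).
  by apply: lerD; apply: ler_wpM2l => //; lra.
have -> : s * (x / w - 1) + (1 - s) * (w^-1 - 1) = 0.
  rewrite /w; field; move: w0; rewrite /w => w0; apply: lt0r_neq0; lra.
lra.
Qed.

(** A quantitative form of strict concavity without derivatives:
    with z = sqrt (1 - t) one has (1 - t)^g = z * z^(2g-1), the second factor is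
    below its tangent at 1, and z <= 1 - t/2 - t^2/8. *)
Lemma powR_onem_le t g : 0 <= t <= 1 -> 1/2 <= g <= 1 ->
  (1 - t) `^ g <= 1 - g * t - (1 - g) / 4 * t ^+ 2.
Proof.
move=> /andP[t0 t1] /andP[g0 g1].
pose z := Num.sqrt (1 - t).
have z0 : 0 <= z by rewrite sqrtr_ge0.
have zz : z ^+ 2 = 1 - t by rewrite sqr_sqrtr//; lra.
have t2 : 0 <= t ^+ 2 by rewrite sqr_ge0.
have t2' : t ^+ 2 <= t by rewrite expr2 ler_piMr.
have zle : z <= 1 - t / 2 - t ^+ 2 / 8.
  rewrite -(@ler_pXn2r _ 2) ?nnegrE//; last by lra.
  rewrite zz.
  have -> : (1 - t / 2 - t ^+ 2 / 8) ^+ 2 = 1 - t + t^+2*t/8 + (t^+2) ^+2 / 64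
    by field.
  have : 0 <= t ^+ 2 * t by rewrite mulr_ge0.
  have : 0 <= (t ^+ 2) ^+ 2 by rewrite sqr_ge0.
  lra.
have -> : (1 - t) `^ g = z `^ (2 * g).
  by rewrite powRrM powR_mulrn// zz.
have h := @powR_tangent z (2 * g - 1) z0 ltac:(lra).
rewrite -[leLHS](mulr_powRB1 z0); last by lra.
have : z * z `^ (2 * g - 1) <= z * (1 + (2 * g - 1) * (z - 1)) by apply: ler_wpM2l.
have -> : z * (1 + (2 * g - 1) * (z - 1)) = (2 - 2 * g) * z + (2 * g - 1)
  * z ^+ 2 by ring.
rewrite zz.
nra.
Qed.

Lemma powR_second_difference u g : 1 <= u -> 1/2 <= g <= 1 ->
  (1 - g) / 4 * u `^ (g - 2) <=
  (u `^ g - (u - 1) `^ g) - ((u + 1) `^ g - u `^ g).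
Proof.
move=> u1 g01.
have u0 : 0 < u by lra.
have t01 : 0 <= u^-1 <= 1 by rewrite invr_ge0 (ltW u0) invf_le1.
have h1 := powR_onem_le t01 g01.
have h2 := @powR_tangent (1 + u^-1) g ltac:(lra) ltac:(lra).
have e1 : ((u - 1) `^ g = (u `^ g) * ((1 - u^-1) `^ g) :> R).
  rewrite -powRM ?(ltW u0)//; last by lra.
  by congr (_ `^ _); field; apply: lt0r_neq0.
have e2 : ((u + 1) `^ g = (u `^ g) * ((1 + u^-1) `^ g) :> R).
  rewrite -powRM ?(ltW u0)//; last by lra.
  by congr (_ `^ _); field; apply: lt0r_neq0.
have e3 : u `^ (g - 2) = u `^ g * u^-1 ^+ 2.
  rewrite powRB; last by apply/implyP => _; apply: lt0r_neq0.
  by rewrite powR_mulrn ?(ltW u0)// exprVn.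
rewrite e1 e2 e3.
have ug0 : 0 <= u `^ g by rewrite powR_ge0.
pose d1 := 1 - g * u^-1 - (1 - g) / 4 * u^-1 ^+ 2 - (1 - u^-1) `^ g.
pose d2 := 1 + g * (1 + u^-1 - 1) - (1 + u^-1) `^ g.
have d12 : 0 <= d1 + d2 by rewrite /d1 /d2; lra.
have := mulr_ge0 ug0 d12; rewrite /d1 /d2; lra.
Qed.

Lemma harmonic_le n : \sum_(1 <= k < n.+1) (k%:R^-1 : R) <= 1 + ln (maxn 1 n)%:R.
Proof.
elim: n => [|n IH]; first by rewrite big_geq// ln1; lra.
rewrite big_nat_recr//=.
case: n IH => [|n] IH.
  by rewrite big_geq// ln1; lra.
rewrite (maxn_idPr _)// in IH; rewrite (maxn_idPr _)//.
have h := @le_ln1Dx R (- n.+2%:R^-1) ltac:(by rewrite ltrN2 invf_lt1// ltr1n).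
have e : 1 - n.+2%:R^-1 = n.+1%:R / n.+2%:R :> R.
  have n2 : n.+2%:R != 0 :> R by rewrite pnatr_eq0.
  have -> : n.+1%:R = n.+2%:R - 1 :> R by rewrite -[n.+2%:R]natr1 addrK.
  by field.
rewrite e ln_div ?posrE ?ltr0n// in h.
move: IH h; move: (\sum_(_ <= _ < _) _) (n.+2%:R^-1) (ln n.+1%:R) (ln n.+2%:R).
by move=> S d l1 l2 *; lra.
Qed.

(** The exponent 1/4 is as large as the final exponent comparison allows; a
    power instead of a logarithm avoids carrying logarithmic factors. *)
Lemma harmonic_le_powR n : (0 < n)%N ->
  \sum_(1 <= k < n.+1) (k%:R^-1 : R) <= 5 * n%:R `^ 4^-1.
Proof.
move=> n0; apply: (le_trans (harmonic_le n)).
rewrite (maxn_idPr n0).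
have n1 : 1 <= n%:R :> R by rewrite ler1n.
have := @ln_sublinear R (n%:R `^ 4^-1) ltac:(by rewrite powR_gt0; lra).
rewrite ln_powR => h.
have : 1 <= n%:R `^ 4^-1 :> R.
  by rewrite -[leLHS](powRr0 n%:R) ler_powR// invr_ge0.
lra.
Qed.

End Elementary.

(** * The Kusmin-Landau inequality *)

Section KusminLandau.
Variable R : realType.
Implicit Types (f : nat -> R) (x y t : R).

Lemma cos_turnDz x (k : int) : cos (2 * pi * (x + k%:~R)) = cos (2 * pi * x).
Proof.
have H (n : nat) y : cos (2 * pi * (y + n%:R)) = cos (2 * pi * y).
  rewrite mulrDr.
  have -> : 2 * pi * n%:R = (pi *+ 2) *+ n :> R by rewrite -[(pi *+ 2) *+
    n]mulr_natr -[pi *+ 2]mulr_natr; ring.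
  by rewrite (periodicn (@cosD2pi R)).
case: k => n; first exact: H.
by rewrite -[LHS](H n.+1); congr (cos (_ * _)); rewrite NegzE mulrNz; ring.
Qed.

(** The identity behind the Kusmin-Landau inequality: a term of an exponential
    sum is a cotangent weight times an increment of the sum's own phases, up to
    an increment that telescopes. *)
Lemma cos_as_cot_increment (a d : R) : sin d != 0 ->
  cos a = 2^-1 * (cos d / sin d * (sin (a + 2 * d) - sin a)
          - (cos (a + 2 * d) - cos a)).
Proof.
move=> sd.
have -> : 2 * d = d *+ 2 by rewrite mulr2n; ring.
rewrite sinD cosD sin_mulr2n cos_mulr2n.
have e : cos d ^+ 2 = 1 - sin d ^+ 2 by rewrite sin2cos2; ring.
have -> : cos d / sin d *
  (sin a * (cos d ^+ 2 *+ 2 - 1) + cos a * (cos d * sin d *+ 2) - sin a) =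
  2 * cos a * cos d ^+ 2 + cos d / sin d * sin a * (2 * cos d ^+ 2 - 2) by field.
rewrite e.
have -> : cos d / sin d * sin a * (2 * (1 - sin d ^+ 2) - 2) = - 2 * cos d
  * sin a * sin d.
  by field.
by field.
Qed.

Lemma cot_le (a b : R) : 0 < a -> a <= b -> b < pi ->
  cos b / sin b <= cos a / sin a.
Proof.
move=> a0 ab bpi.
have sa : 0 < sin a by apply: sin_gt0_pi; lra.
have sb : 0 < sin b by apply: sin_gt0_pi; lra.
rewrite -subr_ge0.
have -> : cos a / sin a - cos b / sin b = sin (b - a) / (sin a * sin b).
  by rewrite sinB; field; rewrite !lt0r_neq0.
apply: divr_ge0; last by rewrite mulr_ge0// ltW.
by apply: sin_ge0_pi; lra.
Qed.

(** Summation by parts: the total variation of a monotone weight bounded by K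
    is at most 2 K, and each of the two boundary terms costs at most K. *)
Lemma abel_monotone (c s : nat -> R) (K : R) (a b : nat) :
  (a <= b)%N -> 0 <= K ->
  (forall n, (a <= n < b)%N -> `|c n| <= K) ->
  (forall n, (a <= n)%N -> (n.+1 < b)%N -> c n <= c n.+1) ->
  (forall n, `|s n| <= 1) ->
  `| \sum_(a <= n < b) c n * (s n.+1 - s n) | <= 4 * K.
Proof.
move=> ab K0 cK cm s1.
have [->|anb] := eqVneq a b.
  by rewrite big_geq// normr0 mulr_ge0.
have {}ab : (a < b)%N by rewrite ltn_neqAle anb.
have H m : (a <= m < b)%N ->
  `| \sum_(a <= n < m.+1) c n * (s n.+1 - s n) - c m * s m.+1 | <= `|c a|
    + (c m - c a).
  elim: m => [|m IH] /andP[am mb].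
    move: am; rewrite leqn0 => /eqP ->.
    rewrite big_nat1.
    have -> : c 0%N * (s 1%N - s 0%N) - c 0%N * s 1%N = - (c 0%N * s 0%N) by ring.
    by rewrite normrN normrM subrr addr0 ler_piMr.
  have [e|am'] := eqVneq a m.+1.
    rewrite -e big_nat1.
    have -> : c a * (s a.+1 - s a) - c a * s a.+1 = - (c a * s a) by ring.
    by rewrite normrN normrM subrr addr0 ler_piMr.
  have am2 : (a <= m)%N by lia.
  rewrite big_nat_recr/=; last exact: am.
  have := IH ltac:(lia).
  set S := \sum_(a <= n < m.+1) _.
  have -> : S + c m.+1 * (s m.+2 - s m.+1) - c m.+1 * s m.+2
     = (S - c m * s m.+1) - (c m.+1 - c m) * s m.+1 by ring.
  have := cm m am2 mb; move=> cmm IH'.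
  apply: (le_trans (ler_normB _ _)).
  have : `|(c m.+1 - c m) * s m.+1| <= c m.+1 - c m.
    by rewrite normrM ger0_norm ?subr_ge0// ler_piMr ?subr_ge0.
  lra.
case: b {anb} ab cK cm H => [//|b] ab cK cm H.
have := H b ltac:(lia).
have ca := cK a ltac:(lia).
have cb := cK b ltac:(lia).
set S := \sum_(a <= n < _) _ => h.
have -> : S = (S - c b * s b.+1) + c b * s b.+1 by ring.
apply: (le_trans (ler_normD _ _)).
have : `|c b * s b.+1| <= K by rewrite normrM (le_trans _ cb)// ler_piMr.
have : - K <= c a by move: ca; rewrite ler_norml => /andP[].
have : c b <= K by move: cb; rewrite ler_norml => /andP[].
lra.
Qed.

(** When the phase increments are monotone and stay at distance th from the
    integers, their cotangents are monotone and O(1 / th), so the sum is that of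
    a monotone bounded weight against increments of a bounded sequence. *)
Lemma kusmin_landau f (th : R) (k : int) (a b : nat) : (a <= b)%N ->
  0 < th <= 2^-1 ->
  (forall n, (a <= n < b)%N ->
     k%:~R + th <= f n.+1 - f n <= k%:~R + 1 - th) ->
  (forall n, (a <= n)%N -> (n.+1 < b)%N ->
     f n.+2 - f n.+1 <= f n.+1 - f n) ->
  `| \sum_(a <= n < b) cos (2 * pi * f n) | <= 3 / th.
Proof.
move=> ab /andP[th0 th2] fD fm.
(* Subtracting n k from the phase places all its increments in (0, 1). *)
pose g n := 2 * pi * (f n - n%:R * k%:~R).
have gE n : cos (2 * pi * f n) = cos (g n).
  rewrite /g -(cos_turnDz (f n - _) (k *+ n)).
  by congr (cos (_ * _)); rewrite rmorphMn/= -mulr_natl; ring.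
under eq_bigr do rewrite gE.
pose d n : R := pi * (f n.+1 - f n - k%:~R).
have gS n : g n + 2 * d n = g n.+1.
  by rewrite /g /d -[n.+1]addn1 natrD; ring.
have pi0 := pi_gt0 R.
have dth n : (a <= n < b)%N -> pi * th <= d n <= pi - pi * th.
  move=> /fD /andP[h1 h2]; rewrite /d; apply/andP; split.
    by rewrite ler_pM2l//; lra.
  by rewrite -{2}[pi]mulr1 -mulrBr ler_pM2l//; lra.
have pth : 0 < pi * th by rewrite mulr_gt0.
have sd n : (a <= n < b)%N -> 0 < sin (d n).
  by move=> /dth /andP[h1 h2]; apply: sin_gt0_pi; lra.
have e : \sum_(a <= n < b) cos (g n) = 2^-1 *
   (\sum_(a <= n < b) cos (d n) / sin (d n) * (sin (g n.+1) - sin (g n))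
    - \sum_(a <= n < b) (cos (g n.+1) - cos (g n))).
  rewrite -sumrB mulr_sumr; apply: eq_big_nat => n nab.
  by rewrite [LHS](@cos_as_cot_increment _ (d n)) ?gS// lt0r_neq0// sd.
rewrite e telescope_sumr// normrM ger0_norm//.
pose K := (pi * th / 2)^-1.
have pth2 : pi * th <= pi / 2 by rewrite ler_pM2l//; lra.
have sK : pi * th / 2 <= sin (pi * th).
  by apply: sin_ge_half; rewrite (ltW pth).
have spth : 0 < sin (pi * th) by apply: lt_le_trans sK; lra.
have K0 : 0 <= K by rewrite invr_ge0; lra.
have cotth : cos (pi * th) / sin (pi * th) <= K.
  apply: (@le_trans _ _ ((sin (pi * th))^-1)).
    by rewrite ler_pdivrMr// mulVf ?lt0r_neq0// cos_le1.
  by rewrite /K lef_pV2// posrE; lra.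
have h := @abel_monotone (fun n => cos (d n) / sin (d n)) (fun n => sin (g n))
  K a b ab K0.
have {}h : `|\sum_(a <= n < b) cos (d n) / sin (d n) * (sin (g n.+1)
  - sin (g n))| <= 4 * K.
  apply: h => [n nab|n an nb|n]; last exact: sin_max.
    have /andP[h1 h2] := dth n nab.
    rewrite ler_norml; apply/andP; split; last first.
      by apply: le_trans cotth; apply: cot_le; lra.
    rewrite lerNl; apply: le_trans cotth.
    have -> : - (cos (d n) / sin (d n)) = cos (pi - d n) / sin (pi - d n).
      rewrite -[pi - d n]opprB cosN sinN.
      have := sinDpi (d n - pi); have := cosDpi (d n - pi); rewrite !subrK => -> ->.
      by rewrite mulNr opprK.
    by apply: cot_le; lra.
  have h1 := dth n ltac:(lia); have h2 := dth n.+1 ltac:(lia).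
  have : d n.+1 <= d n by rewrite /d ler_pM2l// lerD2r fm.
  by move=> ?; apply: cot_le; lra.
have h3 : `|cos (g b) - cos (g a)| <= 2.
  by apply: (le_trans (ler_normB _ _)); have := cos_max (g a);
    have := cos_max (g b); lra.
set S := \sum_(_ <= _ < _) _ in h *.
have h4 := ler_normB S (cos (g b) - cos (g a)).
have piK : K <= th^-1.
  rewrite /K lef_pV2 ?posrE//; last by lra.
  have := pi_ge2 R => p2; have : 2 * th <= pi * th by rewrite ler_pM2r.
  lra.
have th1 : 1 <= th^-1 by rewrite invf_ge1//; lra.
lra.
Qed.

Lemma monotone_split (D : nat -> R) t (a b : nat) : (a <= b)%N ->
  (forall m n, (a <= m)%N -> (m <= n)%N -> (n < b)%N -> D n <= D m) ->
  exists i, [/\ (a <= i <= b)%N,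
    forall n, (a <= n < i)%N -> t <= D n &
    forall n, (i <= n < b)%N -> D n < t].
Proof.
move=> ab; elim: b ab => [|b IH] ab mD.
  by exists 0%N; split=> [|n|n]; lia.
have [e|anb] := eqVneq a b.+1.
  by exists a; split=> [|n|n]; lia.
have ab' : (a <= b)%N by lia.
have [] := IH ab'; first by move=> m n am mn nb; apply: mD => //; lia.
move=> i [aib h1 h2].
have [tD|Dt] := leP t (D b).
  exists b.+1; split; first lia.
    by move=> n /andP[an nb]; apply: (le_trans tD); apply: mD; lia.
  by move=> n; lia.
exists i; split; [lia|by []|].
move=> n nib; have [->//|nb] := eqVneq n b.
by apply: h2; lia.
Qed.

End KusminLandau.

(** * The second derivative test *)

Section SecondDerivative.
Variable R : realType.
Implicit Types (f : nat -> R) (x y t : R).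

(** The increments cross K unit intervals.  In each of them the indices whose
    increment is th-close to an integer are few, because the increments drop by
    at least mu at every step; the remaining ones fall under Kusmin-Landau. *)
Lemma second_difference_blocks f (mu th : R) (a b K : nat) (k : int) :
  (a <= b)%N -> 0 < mu -> 0 < th <= 2^-1 ->
  (forall n, (a <= n)%N -> (n.+1 < b)%N ->
     mu <= (f n.+1 - f n) - (f n.+2 - f n.+1)) ->
  (forall n, (a <= n < b)%N ->
     k%:~R + 1 - th - K%:R <= f n.+1 - f n < k%:~R + 1 - th) ->
  `| \sum_(a <= n < b) cos (2 * pi * f n) |
    <= K%:R * (3 / th + (2 * th / mu + 1)).
Proof.
move=> ab mu0 th01.
have /andP[th0 th2] := th01.
elim: K k a ab => [|K IH] k a ab fc fD.
  have [e|anb] := eqVneq a b; first by rewrite e big_geq// normr0 mul0r.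
  by have /andP[h1 h2] := fD a ltac:(lia); lra.
pose D n := f n.+1 - f n.
have Dmono : forall d m, (a <= m)%N -> (m + d < b)%N -> D (m + d)%N + d%:R * mu
  <= D m.
  elim=> [|d IHd] m am mdb; first by rewrite addn0 mul0r addr0.
  have := IHd m am ltac:(lia); have := fc (m + d)%N ltac:(lia) ltac:(lia).
  rewrite /D addnS -[d.+1]addn1 natrD; lra.
have mD m n : (a <= m)%N -> (m <= n)%N -> (n < b)%N -> D n <= D m.
  move=> am mn nb; have := Dmono (n - m)%N m am ltac:(lia).
  rewrite subnKC//; have : 0 <= (n - m)%:R * mu by rewrite mulr_ge0// ltW.
  by lra.
have [i [aib iU iD]] := monotone_split (k%:~R + th) ab mD.
have ib : (i <= b)%N by lia.
have mDi m n : (i <= m)%N -> (m <= n)%N -> (n < b)%N -> D n <= D m.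
  by move=> am; apply: mD; lia.
have [j [ijb jU jD]] := monotone_split (k%:~R - th) ib mDi.
rewrite (@big_cat_nat _ _ _ i)/=; [|lia|lia].
rewrite (@big_cat_nat _ _ _ j i b)/=; [|lia|lia].
have b1 : `|\sum_(a <= n < i) cos (2 * pi * f n)| <= 3 / th.
  apply: (@kusmin_landau R f th k) => //; first lia.
    move=> n nai; have /andP[h1 h2] := fD n ltac:(lia); have h3 := iU n nai.
    by rewrite /D in h3; apply/andP; split=> //; apply: ltW.
  by move=> n an ni; have := fc n an ltac:(lia); lra.
have b2 : `|\sum_(i <= n < j) cos (2 * pi * f n)| <= 2 * th / mu + 1.
  apply: (le_trans (ler_norm_sum _ _ _)).
  apply: (@le_trans _ _ (\sum_(i <= n < j) 1)).
    by apply: ler_sum => n _; apply: cos_max.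
  rewrite sumr_const_nat.
  have [e|ij] := leqP j i.
    have -> : (j - i = 0)%N by lia.
    have : 0 <= 2 * th / mu by rewrite divr_ge0//; lra.
    by rewrite mulr0n; lra.
  have := Dmono (j.-1 - i)%N i ltac:(lia) ltac:(lia).
  rewrite subnKC; last lia.
  have := jU j.-1 ltac:(lia); have := iD i ltac:(lia) => h1 h2 h3.
  have : (j.-1 - i)%:R * mu <= 2 * th by lra.
  rewrite -ler_pdivlMr// => h4.
  have -> : (j - i = (j.-1 - i).+1)%N by lia.
  by rewrite -[_.+1]addn1 mulrnDr; lra.
have b3 : `|\sum_(j <= n < b) cos (2 * pi * f n)| <= K%:R * (3 / th + (2
  * th / mu + 1)).
  apply: (IH (k - 1)); first lia.
    by move=> n jn nb; apply: fc => //; lia.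
  move=> n njb; have /andP[h1 h2] := fD n ltac:(lia); have h3 := jD n njb.
  by move: h1 h2 h3; rewrite /D rmorphB/= -[K.+1]addn1 natrD; lra.
apply: (le_trans (ler_normD _ _)).
have := ler_normD (\sum_(i <= n < j) cos (2 * pi * f n)) (\sum_(j
  <= n < b) cos (2 * pi * f n)).
have -> : K.+1%:R * (3 / th + (2 * th / mu + 1)) = K%:R * (3 / th + (2
  * th / mu + 1)) + (3 / th + (2 * th / mu + 1)).
  by rewrite -[K.+1%:R]natr1; ring.
set B := K%:R * (3 / th + (2 * th / mu + 1)) in b3 *.
set X := 3 / th in b1 b3 *; set Y := 2 * th / mu in b2 b3 *.
set S1 := \sum_(a <= n < i) _ in b1 *; set S2 := \sum_(i <= n < j) _ in b2 *.
by set S3 := \sum_(j <= n < b) _ in b3 *; clearbody S1 S2 S3 B X Y; lra.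
Qed.

(** The choice th = sqrt mu balances the two contributions of a block. *)
Lemma second_difference_test f (mu : R) (a b V : nat) :
  (a < b)%N -> 0 < mu <= 4^-1 ->
  (forall n, (a <= n)%N -> (n.+1 < b)%N ->
     mu <= (f n.+1 - f n) - (f n.+2 - f n.+1)) ->
  (forall n, (a <= n < b)%N -> f a.+1 - f a - V%:R <= f n.+1 - f n <= f a.+1
    - f a) ->
  `| \sum_(a <= n < b) cos (2 * pi * f n) | <= V.+1%:R * (6 / Num.sqrt mu).
Proof.
move=> ab /andP[mu0 mu4] fc fD.
pose th := Num.sqrt mu.
have th0 : 0 < th by rewrite sqrtr_gt0.
have thth : th ^+ 2 = mu by rewrite sqr_sqrtr// ltW.
have th2 : th <= 2^-1.
  by rewrite -(@ler_pXn2r _ 2) ?nnegrE//; [rewrite thth exprVn; lra|exact: ltW].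
(* The first block is the one that contains the largest increment. *)
pose k := Num.floor (f a.+1 - f a + th).
have := floor_itv (f a.+1 - f a + th); rewrite -/k intrD1 => /andP[k1 k2].
have := @second_difference_blocks f mu th a b V.+1 k (ltnW ab) mu0 ltac:(lra) fc.
have -> : 2 * th / mu = 2 / th by rewrite -thth; field; apply: lt0r_neq0.
move=> H; apply: (le_trans (H _)).
  move=> n nab; have := fD n nab => /andP[h1 h2].
  rewrite -[V.+1]addn1 natrD; lra.
apply: ler_wpM2l => //.
have : 2 <= th^-1 by rewrite -[leLHS]invrK lef_pV2// posrE; lra.
rewrite -/th; lra.
Qed.

(** The second derivative test for the phase h m^g + al m + ph.  The linear part
    does not affect second differences, which is why the bound is uniform in al;
    the increments of m^g lie in [0, 1], so those of the phase range over an
    interval of length h. *)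
Lemma powR_phase_sum (g al ph : R) (h l : nat) :
  1/2 <= g < 1 -> (0 < h <= l)%N ->
  `| \sum_(1 <= m < l.+1) cos (2 * pi * (h%:R * m%:R `^ g + al * m%:R + ph)) |
  <= 24 / Num.sqrt (1 - g) * (Num.sqrt h%:R * l%:R `^ (1 - g / 2)).
Proof.
move=> /andP[g0 g1] /andP[h0 hl].
have l0 : (0 < l)%N by lia.
have lp : 0 < l%:R :> R by rewrite ltr0n.
have l1 : 1 <= l%:R :> R by rewrite ler1n.
have hp : 0 < h%:R :> R by rewrite ltr0n.
pose f (m : nat) := h%:R * m%:R `^ g + al * m%:R + ph.
pose D (n : nat) : R := n.+1%:R `^ g - n%:R `^ g.
have fD n : f n.+1 - f n = h%:R * D n + al.
  have e : n.+1%:R = n%:R + 1 :> R by rewrite natr1.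
  by rewrite /f /D [in al * _]e; ring.
pose mu := h%:R * ((1 - g) / 4 * l%:R `^ (g - 2)).
have mu0 : 0 < mu.
  by rewrite /mu !mulr_gt0// ?powR_gt0//; lra.
(* The curvature is small because h <= l. *)
have mu4 : mu <= 4^-1.
  have : h%:R * l%:R `^ (g - 2) <= 1.
    apply: (@le_trans _ _ (l%:R * l%:R `^ (g - 2))).
      by rewrite ler_wpM2r ?powR_ge0// ler_nat.
    have -> : g - 2 = (g - 1) - 1 by ring.
    rewrite mulrC (@powRB _ _ (g - 1) 1); last by rewrite (gt_eqF lp) implybT.
    rewrite powRr1 ?(ltW lp)// divfK ?(gt_eqF lp)//.
    by rewrite -[leRHS](powRr0 l%:R) ler_powR//; lra.
  have x0 : 0 <= h%:R * l%:R `^ (g - 2) by rewrite mulr_ge0// ?powR_ge0// ltW.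
  have -> : mu = (1 - g) / 4 * (h%:R * l%:R `^ (g - 2)) by rewrite /mu; ring.
  move=> x1; have : (1 - g) * (h%:R * l%:R `^ (g - 2)) <= 1 * 1.
    by apply: ler_pM => //; lra.
  lra.
have Ddec n : (n < l)%N -> (1 - g) / 4 * l%:R `^ (g - 2) <= D n - D n.+1.
  move=> nl.
  have u1 : 1 <= n.+1%:R :> R by rewrite ler1n.
  have := powR_second_difference u1 (_ : 1/2 <= g <= 1); rewrite natr1.
  have -> : n.+1%:R - 1 = n%:R :> R by rewrite -[n.+1%:R]natr1 addrK.
  move=> H.
  apply: le_trans (H ltac:(lra)); apply: ler_wpM2l; first lra.
  rewrite -[g - 2]opprB !powRN lef_pV2 ?posrE ?powR_gt0 ?ltr0n//.
  by rewrite ge0_ler_powR ?nnegrE ?ler_nat//; lra.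
have D0 n : 0 <= D n.
  by rewrite subr_ge0 ge0_ler_powR ?nnegrE ?ler_nat//; lra.
have D1 n : D n <= 1.
  case: n => [|n]; first by rewrite /D powR1 powR0 ?subr0// gt_eqF//; lra.
  rewrite /D.
  have e : n.+2%:R = n.+1%:R * (1 + n.+1%:R^-1) :> R.
    by rewrite mulrDr mulr1 mulfV ?natr1// gt_eqF.
  have n1 : 1 <= n.+1%:R :> R by rewrite ler1n.
  rewrite e; move: n1; set u : R := n.+1%:R; move: u => u u1.
  have u0 : 0 < u by lra.
  have uV : u * u^-1 = 1 by rewrite mulfV// gt_eqF.
  have v0 : 0 < u^-1 by rewrite invr_gt0.
  move: uV v0; move: (u^-1) => v uV v0.
  rewrite powRM ?(ltW u0)//; last lra.
  have H := @powR_tangent R (1 + v) g ltac:(lra) ltac:(lra).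
  have : u `^ g * (1 + v) `^ g <= u `^ g * (1 + g * v).
    by apply: ler_wpM2l; rewrite ?powR_ge0//; lra.
  have H2 : u `^ g <= u by apply: ler1_powR => //; lra.
  have : u `^ g * (g * v) <= u * v.
    by apply: ler_pM; rewrite ?powR_ge0 ?mulr_ge0 ?(ltW v0)//;
      [lra|rewrite ler_piMl//; lra].
  rewrite uV; lra.
have Dmono : forall d n, (n + d <= l)%N -> D (n + d)%N <= D n.
  elim=> [|d IHd] n ndl; first by rewrite addn0.
  have := IHd n ltac:(lia); have := Ddec (n + d)%N ltac:(lia).
  have : 0 <= (1 - g) / 4 * l%:R `^ (g - 2) by rewrite mulr_ge0 ?powR_ge0//; lra.
  by rewrite addnS; lra.
have := @second_difference_test f mu 1 l.+1 h ltac:(lia) ltac:(lra).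
move=> H; apply: (le_trans (H _ _)).
- move=> n n1 nl; rewrite !fD /mu.
  have -> : h%:R * D n + al - (h%:R * D n.+1 + al) = h%:R * (D n - D n.+1) by ring.
  by rewrite ler_pM2l// Ddec.
- move=> n /andP[n1 nl]; rewrite !fD; apply/andP; split.
    have := D1 1%N; have := D0 n => dn d1.
    have : h%:R * D 1%N <= h%:R * 1 by rewrite ler_pM2l.
    have : 0 <= h%:R * D n by rewrite mulr_ge0// ltW.
    lra.
  rewrite lerD2r ler_pM2l//.
  by have := Dmono (n - 1)%N 1%N ltac:(lia); rewrite subnKC.
have -> : Num.sqrt mu = Num.sqrt h%:R * (Num.sqrt (1 - g) / 2 * (l%:R `^ (1
  - g / 2))^-1).
  rewrite /mu sqrtrM ?(ltW hp)// sqrtrM ?sqrtrM; [|lra..].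
  congr (_ * (_ * _)).
    have -> : 4^-1 = (2^-1) ^+ 2 :> R by field.
    by rewrite sqrtr_sqr ger0_norm.
  rewrite -powR12_sqrt ?powR_ge0// -powRrM -powRN; congr (_ `^ _); by field.
have s0 : 0 < Num.sqrt h%:R :> R by rewrite sqrtr_gt0.
have sg0 : 0 < Num.sqrt (1 - g) by rewrite sqrtr_gt0; lra.
have p0 : 0 < l%:R `^ (1 - g / 2) by rewrite powR_gt0.
have -> : 6 / (Num.sqrt h%:R * (Num.sqrt (1 - g) / 2 * (l%:R `^ (1 - g / 2))^-1))
   = 12 / Num.sqrt (1 - g) * l%:R `^ (1 - g / 2) / Num.sqrt h%:R.
  by field; rewrite !gt_eqF.
have h2 : h.+1%:R <= 2 * h%:R :> R.
  by rewrite -natrM ler_nat; lia.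
have hh : h%:R = Num.sqrt h%:R * Num.sqrt h%:R :> R by rewrite -expr2 sqr_sqrtr
  ?ltW.
apply: (@le_trans _ _ ((2 * h%:R) * (12 / Num.sqrt (1 - g) * l%:R `^ (1
  - g / 2) / Num.sqrt h%:R))).
  by apply: ler_wpM2r => //; rewrite !mulr_ge0 ?invr_ge0 ?ltW.
rewrite [X in 2 * X]hh le_eqVlt; apply/orP; left; apply/eqP.
by field; rewrite !gt_eqF.
Qed.

End SecondDerivative.

(** * The truncated Fourier series of the sawtooth *)

Section Sawtooth.
Variable R : realType.
Implicit Types (x y t : R).

Lemma sin_le_id x : 0 <= x -> sin x <= x.
Proof.
move=> x0; have [->|xn0] := eqVneq x 0; first by rewrite sin0.
have xp : 0 < x by rewrite lt0r xn0.
have [z zI szE] := @MVT R sin cos 0 x xp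
  (fun z _ => is_derive_sin z) (continuous_subspaceT (@continuous_sin R)).
move: szE; rewrite sin0 !subr0 => ->.
by rewrite ler_piMl// cos_le1.
Qed.

(** The Fourier series of the sawtooth 1/2 - y on (0, 1) is the sum over h of
    sin (2 pi h y) / (pi h); this is the error of its truncation at H. *)
Definition sawtooth_tail (H : nat) y : R :=
  y - 2^-1 + \sum_(h < H) sin (2 * pi * h.+1%:R * y) / (pi * h.+1%:R).

Lemma dirichlet_kernel (H : nat) x :
  sin (pi * x) * (1 + 2 * \sum_(h < H) cos (2 * pi * h.+1%:R * x))
  = sin ((2 * H + 1)%:R * pi * x).
Proof.
elim: H => [|H IH]; first by rewrite big_ord0 mulr0 addr0 mulr1 mul1r.
rewrite big_ord_recr/= [2 * _]mulrDr addrA mulrDr IH.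
set p := pi * x.
have -> : (2 * H + 1)%:R * pi * x = 2 * pi * H.+1%:R * x - p.
  by rewrite /p natrD natrM -[H.+1%:R]natr1; ring.
have -> : (2 * H.+1 + 1)%:R * pi * x = 2 * pi * H.+1%:R * x + p.
  by rewrite /p natrD natrM; ring.
by rewrite sinB sinD; ring.
Qed.

Lemma is_derive_saw_error H x :
  is_derive x 1 (sawtooth_tail H) (1 + 2 * \sum_(h < H) cos (2 * pi * h.+1%:R * x)).
Proof.
rewrite /sawtooth_tail.
pose F (h : 'I_H) (y : R) := sin (2 * pi * h.+1%:R * y) / (pi * h.+1%:R).
have dF (h : 'I_H) : is_derive x 1 (F h) (2 * cos (2 * pi * h.+1%:R * x)).
  rewrite /F.
  apply: is_derive_eq.
  rewrite !scaler1 ?scaler0 ?addr0 ?add0r /GRing.scale/=.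
  have pin : pi != 0 :> R by rewrite gt_eqF// pi_gt0.
  have hn : h.+1%:R != 0 :> R by rewrite pnatr_eq0.
  move: (cos _) => w; move: pin hn; move: (pi : R) (h.+1%:R : R) => p u pn un.
  by field; rewrite un pn.
have := @is_derive_sum R R^o R^o H F x 1 (fun h => 2 * cos (2 * pi * h.+1%:R
  * x)) dF.
move=> dS.
have e : (fun y => y - 2^-1 + \sum_(h < H) sin (2 * pi * h.+1%:R * y) / (pi
  * h.+1%:R)) =
  (fun y => y - 2^-1) + \sum_(h < H) F h :> (R -> R).
  by apply/funext => y; rewrite fctE fct_sumE.
rewrite e.
apply: is_derive_eq.
by rewrite scaler0 !oppr0 addr0 mulr_sumr.
Qed.


Lemma sawtooth_tail_half H : sawtooth_tail H (2^-1) = 0.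
Proof.
rewrite /sawtooth_tail subrr add0r big1// => h _.
have -> : 2 * pi * h.+1%:R * 2^-1 = pi *+ h.+1 :> R.
  by rewrite -[RHS]mulr_natr; field.
suff -> : sin (pi *+ h.+1 : R) = 0 by rewrite mul0r.
elim: {h}(h.+1) => [|n IH]; first by rewrite mulr0n sin0.
by rewrite [pi *+ _]mulrSr sinDpi IH oppr0.
Qed.

(** The derivative of the tail is the Dirichlet kernel sin (N pi z) / sin (pi z),
    N = 2 H + 1.  Adding (cos (N pi z) + e) / (N pi sin (pi z)) cancels the
    oscillating part and, for e = 1 or e = -1, leaves a function of constant
    monotonicity on [y, 1/2]; at 1/2 the tail vanishes. *)
Lemma sawtooth_tail_le_half H y : 0 < y <= 2^-1 ->
  `|sawtooth_tail H y| <= 2 / ((2 * H + 1)%:R * pi * sin (pi * y)).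
Proof.
move=> /andP[y0 y2].
have pi0 := pi_gt0 R.
set N : R := (2 * H + 1)%:R.
have N0 : 0 < N by rewrite ltr0n addn1.
have [->|yn2] := eqVneq y 2^-1.
  rewrite sawtooth_tail_half normr0 divr_ge0// !mulr_ge0 ?(ltW pi0)//.
  by apply: sin_ge0_pi; lra.
have {}y2 : y < 2^-1 by rewrite lt_neqAle yn2.
have s0 z : y <= z <= 2^-1 -> 0 < sin (pi * z).
  move=> /andP[yz z2]; apply: sin_gt0_pi; apply/andP; split.
    by rewrite mulr_gt0//; lra.
  by rewrite gtr_pMr//; lra.
pose E z := cos (N * pi * z).
pose Q (e z : R) := sawtooth_tail H z + (E z + e) / (N * pi * sin (pi * z)).
pose dQ (e z : R) := - (E z + e) * cos (pi * z) / (N * sin (pi * z) ^+ 2).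
have dQE e z : y <= z <= 2^-1 -> is_derive z 1 (Q e) (dQ e z).
  move=> zI; have sz := s0 z zI.
  have szn : N * pi * sin (pi * z) != 0 by rewrite gt_eqF// !mulr_gt0.
  rewrite /Q /E.
  have d1 := is_derive_saw_error H z.
  have d2 : is_derive z 1 (fun z => cos (N * pi * z) + e) (- sin (N * pi * z)
    * (N * pi)).
    apply: is_derive_eq.
    by rewrite !scaler1 ?scaler0 ?addr0 /GRing.scale/= mulrC; ring.
  have d3 : is_derive z 1 (fun z => N * pi * sin (pi * z)) (N * pi * (cos (pi
    * z) * pi)).
    apply: is_derive_eq.
    by rewrite /GRing.scale/=; ring.
  apply: is_derive_eq.
  rewrite -(dirichlet_kernel H z) /dQ /E /GRing.scale/=.
  have := gt_eqF N0; have := gt_eqF pi0; have := gt_eqF sz.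
  move: (1 + 2 * _) (sin _) (cos (N * pi * z)) (cos _) => D sn cN cz.
  move: (pi : R) (N) => p n sn0 p0 Nn0.
  by field; rewrite sn0 p0 Nn0.
have Q2 e : Q e 2^-1 = (cos (N * (pi / 2)) + e) / (N * pi).
  by rewrite /Q sawtooth_tail_half add0r sin_pihalf mulr1 /E mulrA.
have cN : cos (N * (pi / 2)) = 0.
  have -> : N * (pi / 2) = pi / 2 + pi *+ H.
    by rewrite /N natrD natrM -mulr_natr; field.
  elim: {Q2 Q dQ dQE E N N0}H => [|H IH]; first by rewrite mulr0n addr0 cos_pihalf.
  by rewrite [pi *+ _]mulrSr addrA cosDpi IH oppr0.
have cz0 z : y <= z <= 2^-1 -> 0 <= cos (pi * z).
  move=> /andP[yz z2]; apply: cos_ge0_pihalf; apply/andP; split.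
    by apply: (@le_trans _ _ 0); [lra|rewrite mulr_ge0//; lra].
  by rewrite ler_pM2l.
have mvt e : exists2 z, y <= z <= 2^-1 & Q e 2^-1 - Q e y = dQ e z * (2^-1 - y).
  have dz z : z \in `]y, 2^-1[ -> is_derive z 1 (Q e) (dQ e z).
    by rewrite in_itv/= => /andP[? ?]; apply: dQE; lra.
  have [|z] := @MVT R (Q e) (dQ e) y 2^-1 y2 dz.
    apply: derivable_within_continuous => z; rewrite in_itv/= => zI.
    by have [] := dQE e z zI.
  by rewrite in_itv/= => /andP[? ?] ze; exists z => //; lra.
have sy : 0 < sin (pi * y) by apply: s0; lra.
have Npi : 0 < N * pi by rewrite mulr_gt0.
have den z : y <= z <= 2^-1 -> 0 <= (N * sin (pi * z) ^+ 2)^-1.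
  by move=> zI; rewrite invr_ge0 mulr_ge0 ?sqr_ge0// ltW.
have hi : 0 <= Q 1 y.
  have [z zI ze] := mvt 1.
  have : dQ 1 z * (2^-1 - y) <= 0.
    apply: mulr_le0_ge0; last by lra.
    rewrite /dQ mulNr mulNr oppr_le0 mulr_ge0 ?den// mulr_ge0 ?cz0//.
    by rewrite /E; have := cos_geN1 (N * pi * z); lra.
  have : 0 <= Q 1 2^-1 by rewrite Q2 cN add0r divr_ge0// ltW.
  lra.
have lo : Q (-1) y <= 0.
  have [z zI ze] := mvt (-1).
  have : 0 <= dQ (-1) z * (2^-1 - y).
    apply: mulr_ge0; last by lra.
    rewrite /dQ -mulrA mulr_ge0 ?mulr_ge0 ?den ?cz0//.
    by rewrite /E; have := cos_le1 (N * pi * z); lra.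
  have : Q (-1) 2^-1 <= 0 by rewrite Q2 cN add0r mulNr oppr_le0 divr_ge0// ltW.
  lra.
move: hi lo; rewrite /Q.
have Ns : 0 < (N * pi * sin (pi * y))^-1 by rewrite invr_gt0 mulr_gt0.
move: Ns; move: (_^-1) => w w0 hi lo.
have h1 : (E y + 1) * w <= 2 * w.
  by rewrite ler_pM2r// /E; have := cos_le1 (N * pi * y); lra.
have h2 : - 2 * w <= (E y + -1) * w.
  by rewrite ler_pM2r// /E; have := cos_geN1 (N * pi * y); lra.
by rewrite ler_norml; apply/andP; split; lra.
Qed.

Lemma sawtooth_tail_sym H y : sawtooth_tail H (1 - y) = - sawtooth_tail H y.
Proof.
rewrite /sawtooth_tail opprD -sumrN; congr (_ + _); first by field.
apply: eq_bigr => h _; rewrite -mulNr -sinN; congr (_ / _).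
have -> : 2 * pi * h.+1%:R * (1 - y) = - (2 * pi * h.+1%:R * y) + (pi *+ 2) *+
  h.+1 :> R.
  by rewrite -[_ *+ h.+1]mulr_natr -[pi *+ 2]mulr_natr; ring.
by rewrite (periodicn (@sinD2pi R)).
Qed.

(** Near 0, where the bound through the Dirichlet kernel is useless, the tail is
    bounded because each of the H terms of the series is at most 2 y. *)
Lemma sawtooth_tail_le H y : (0 < H)%N -> 0 <= y <= 2^-1 ->
  `|sawtooth_tail H y| <= 3 /\ `|sawtooth_tail H y| * (H%:R * y) <= 2^-1.
Proof.
move=> H0 /andP[y0 y2].
have Hp : 0 < H%:R :> R by rewrite ltr0n.
have pi0 := pi_gt0 R; have pi2 := pi_ge2 R.
have small : `|sawtooth_tail H y| <= 2^-1 + 2 * (H%:R * y).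
  apply: (le_trans (ler_normD _ _)); apply: lerD.
    by rewrite ler_norml; lra.
  apply: (le_trans (ler_norm_sum _ _ _)).
  apply: (@le_trans _ _ (\sum_(h < H) (2 * y))); last first.
    by rewrite sumr_const card_ord -mulr_natl; lra.
  apply: ler_sum => h _.
  have d0 : 0 < pi * h.+1%:R :> R by rewrite mulr_gt0.
  rewrite normrM (@gtr0_norm _ (pi * _)^-1) ?invr_gt0// ler_pdivrMr//.
  have -> : 2 * y * (pi * h.+1%:R) = 2 * pi * h.+1%:R * y :> R by ring.
  set z := 2 * pi * _ * y.
  have z0 : 0 <= z by rewrite /z !mulr_ge0// ltW.
  have [z1|z1] := leP z 1; last by rewrite (le_trans (sin_max z))// ltW.
  rewrite ger0_norm ?sin_le_id//.
  by apply: sin_ge0_pi; lra.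
have [e|yn0] := eqVneq y 0.
  by rewrite e !mulr0 in small *; split; lra.
have yp : 0 < y by rewrite lt0r yn0.
have big : `|sawtooth_tail H y| * (H%:R * y) <= 2^-1.
  have := @sawtooth_tail_le_half H y ltac:(lra).
  set N : R := (2 * H + 1)%:R => b.
  have N2 : 2 * H%:R <= N by rewrite /N natrD natrM; lra.
  have s2 : pi * y / 2 <= sin (pi * y).
    apply: sin_ge_half; rewrite mulr_ge0 ?(ltW pi0)//=.
    by rewrite ler_pM2l.
  have s0 : 0 < pi * y / 2 by rewrite divr_gt0// mulr_gt0.
  have d0 : 0 < 2 * H%:R * 2 * (2 * y / 2) by rewrite !mulr_gt0.
  have dle : 2 * H%:R * 2 * (2 * y / 2) <= N * pi * sin (pi * y).
    have H2 : 0 <= 2 * H%:R :> R by rewrite mulr_ge0.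
    apply: ler_pM; [by rewrite mulr_ge0|lra|by apply: ler_pM|].
    by apply: le_trans s2; rewrite ler_pM2r// ler_pM2r.
  have : 2 / (N * pi * sin (pi * y)) <= 2 / (2 * H%:R * 2 * (2 * y / 2)).
    by rewrite ler_pM2l// lef_pV2// posrE; apply: lt_le_trans dle.
  move=> b2; have {b2} b : `|sawtooth_tail H y| <= 2 / (2 * H%:R * 2 * (2
    * y / 2)) by apply: le_trans b b2.
  have -> : 2^-1 = 2 / (2 * H%:R * 2 * (2 * y / 2)) * (H%:R * y) :> R.
    by field; rewrite yn0 gt_eqF.
  by rewrite ler_pM2r// mulr_gt0.
split=> //.
have [hy|hy] := leP (H%:R * y) 1; first lra.
have : `|sawtooth_tail H y| * 1 <= `|sawtooth_tail H y| * (H%:R * y).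
  by apply: ler_wpM2l => //; exact: ltW.
lra.
Qed.


End Sawtooth.

(** * Sawtooth sums twisted by a linear phase *)

Section SawtoothSums.
Variable R : realType.
Implicit Types (x y t : R).

(** This is k times the usual Fejer kernel, written as the double sum that comes
    from squaring a geometric sum. *)
Definition fejer (k : nat) y : R :=
  \sum_(h < k) \sum_(i < k) cos (2 * pi * ((h%:R - i%:R) * y)).

Lemma fejerE k y : fejer k y =
  (\sum_(h < k) cos (2 * pi * (h%:R * y))) ^+ 2 +
  (\sum_(h < k) sin (2 * pi * (h%:R * y))) ^+ 2.
Proof.
rewrite !expr2 !big_distrlr/= -big_split/=; apply: eq_bigr => h _.
rewrite -big_split/=; apply: eq_bigr => i _.
by rewrite -cosB; congr cos; ring.
Qed.

Lemma fejer_ge0 k y : 0 <= fejer k y.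
Proof. by rewrite fejerE addr_ge0// sqr_ge0. Qed.

Lemma fejer_sym k y : fejer k (1 - y) = fejer k y.
Proof.
apply: eq_bigr => h _; apply: eq_bigr => i _.
rewrite -[RHS]cosN -mulrN -(cos_turnDz (- ((h%:R - i%:R) * y)) (h%:Z - i%:Z)).
by congr (cos (_ * _)); rewrite rmorphB/=; ring.
Qed.

Lemma cos_ge_half x : 0 <= x <= 1 -> 2^-1 <= cos x.
Proof.
move=> /andP[x0 x1].
have -> : x = (x / 2) *+ 2 by rewrite -mulr_natr; field.
rewrite cos_mulr2n cos2sin2.
have h0 : 0 <= sin (x / 2) by apply: sin_ge0_pi; have := pi_ge2 R; lra.
have h1 : sin (x / 2) <= x / 2 by apply: sin_le_id; lra.
have : sin (x / 2) ^+ 2 <= 2^-1 ^+ 2 by rewrite ler_pXn2r ?nnegrE//; lra.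
by rewrite exprVn; lra.
Qed.

(** For y this close to 0 all the k terms of the geometric sum have real part at
    least 1/2. *)
Lemma fejer_large k y : 0 <= y -> 8 * k%:R * y <= 1 -> k%:R ^+ 2 / 4 <= fejer k y.
Proof.
move=> y0 ky; rewrite fejerE -[leLHS]addr0 lerD ?sqr_ge0//.
have -> : k%:R ^+ 2 / 4 = (k%:R / 2) ^+ 2 :> R by field.
have : k%:R / 2 <= \sum_(h < k) cos (2 * pi * (h%:R * y)).
  have -> : k%:R / 2 = \sum_(h < k) (2^-1 : R) by rewrite sumr_const card_ord
    -[RHS]mulr_natl.
  apply: ler_sum => h _; apply: cos_ge_half.
  have pi0 := pi_gt0 R; have pi4 : pi <= 4 :> R by have := pihalf_lt2 R; lra.
  rewrite !mulr_ge0 ?(ltW pi0)//=.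
  have hy : h%:R * y <= k%:R * y by rewrite ler_wpM2r// ler_nat ltnW.
  have : 2 * pi * (h%:R * y) <= 2 * 4 * (k%:R * y).
    by apply: ler_pM => //; rewrite ?mulr_ge0 ?(ltW pi0)//; lra.
  lra.
move=> h; have k0 : 0 <= k%:R / 2 :> R by rewrite divr_ge0.
by rewrite ler_pXn2r ?nnegrE// (le_trans k0).
Qed.

(** For y <= 1/2 about min(H, 1/(8 y)) of the integers k <= H satisfy 8 k y <= 1,
    and for these the k-th Fejer term is at least 1.  Hence the right-hand side
    is at least of order min(1, 1/(H y)), which dominates the tail. *)
Lemma sawtooth_tail_majorant H y : (0 < H)%N -> 0 <= y < 1 ->
  `|sawtooth_tail H y| <=
  12 / H%:R * (1 + \sum_(1 <= k < H.+1) 4 / k%:R ^+ 2 * fejer k y).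
Proof.
move=> H0 /andP[y0 y1].
have Hp : 0 < H%:R :> R by rewrite ltr0n.
(* The tail is odd and the Fejer terms are even under y -> 1 - y. *)
wlog y2 : y y0 y1 / y <= 2^-1.
  move=> W; have [|y2] := leP y 2^-1; first exact: W.
  have := W (1 - y) ltac:(lra) ltac:(lra) ltac:(lra).
  rewrite sawtooth_tail_sym normrN.
  under eq_bigr do rewrite fejer_sym.
  by [].
have key K : (K <= H)%N -> 8 * K%:R * y <= 1 ->
    K%:R <= \sum_(1 <= k < H.+1) 4 / k%:R ^+ 2 * fejer k y.
  move=> KH Ky; rewrite (@big_cat_nat _ _ _ K.+1)//=.
  rewrite -[leLHS]addr0 lerD//; last first.
    by apply: sumr_ge0 => k _; rewrite mulr_ge0 ?fejer_ge0.
  have -> : K%:R = \sum_(1 <= k < K.+1) (1 : R) by rewrite sumr_const_nat subn1.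
  apply: ler_sum_nat => k /andP[k1 kK].
  have kp : 0 < k%:R :> R by rewrite ltr0n.
  have kR : k%:R <= K%:R :> R by rewrite ler_nat; lia.
  have : k%:R ^+ 2 / 4 <= fejer k y.
    apply: fejer_large => //; apply: le_trans Ky.
    by rewrite ler_wpM2r// ler_wpM2l.
  have c0 : 0 < 4 / k%:R ^+ 2 :> R by rewrite divr_gt0// exprn_gt0.
  rewrite -(ler_pM2l c0); apply: le_trans.
  by apply: le_of_eq; field; rewrite gt_eqF.
have [s3 sH] := @sawtooth_tail_le R H y H0 ltac:(lra).
set S := \sum_(_ <= _ < _) _ in key *.
have [small|big] := leP (8 * H%:R * y) 1.
  have := key H (leqnn H) small => hS.
  have : 12 / H%:R * H%:R <= 12 / H%:R * (1 + S).
    by rewrite ler_pM2l ?divr_gt0//; lra.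
  rewrite divfK ?gt_eqF//; lra.
have yp : 0 < y.
  by rewrite lt0r y0 andbT; apply/eqP => e; move: big; rewrite e; lra.
pose z := (8 * y)^-1.
have z0 : 0 <= z by rewrite invr_ge0; lra.
have zy : 8 * z * y = 1 by rewrite /z; field; rewrite gt_eqF.
have := truncn_itv z0; set K := Num.truncn z => /andP[K1 K2].
have KH : (K <= H)%N.
  rewrite -(ler_nat R); apply: (le_trans K1).
  have : 8 * y * z <= 8 * y * H%:R by lra.
  by rewrite ler_pM2l//; lra.
have hS : K%:R <= S.
  apply: key => //; rewrite -[leRHS]zy ler_wpM2r// ler_wpM2l//.
have zS : z <= 1 + S.
  by move: K2; rewrite -natr1; lra.
have : 12 / H%:R * z <= 12 / H%:R * (1 + S) by rewrite ler_pM2l// divr_gt0.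
apply: le_trans.
have Hy0 : 0 < H%:R * y by rewrite mulr_gt0.
rewrite -(ler_pM2r Hy0); apply: (le_trans sH).
have -> : 12 / H%:R * z * (H%:R * y) = 12 / 8 * (8 * z * y).
  by field; rewrite gt_eqF.
rewrite zy; lra.
Qed.

(** An inequality of Erdos-Turan type, with a linear twist.  The truncated
    Fourier series produces twisted sums of frequency h with weight 1 / (pi h),
    and the Fejer majorant of the tail produces untwisted ones; the diagonal
    terms of the Fejer kernels give the terms with l / H. *)
Lemma weighted_sawtooth_sum (y : nat -> R) (l H : nat) (B al ph : R) :
  (0 < H)%N ->
  (forall m, 0 <= y m < 1) ->
  (forall (h : nat) (a p : R), (0 < h <= H)%N ->
    `| \sum_(1 <= m < l.+1) cos (2 * pi * (h%:R * y m + a * m%:R + p)) | <= B) ->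
  `| \sum_(1 <= m < l.+1) (y m - 2^-1) * cos (2 * pi * (al * m%:R + ph)) |
  <= (\sum_(1 <= k < H.+1) k%:R^-1) * (B + 48 * l%:R / H%:R)
     + 48 * B + 12 * l%:R / H%:R.
Proof.
move=> H0 y01 hB.
have Hp : 0 < H%:R :> R by rewrite ltr0n.
have B0 : 0 <= B by apply: le_trans (hB 1%N 0 0 _) => //; lia.
have pi0 := pi_gt0 R; have pi2 := pi_ge2 R.
set Har := \sum_(1 <= k < H.+1) k%:R^-1.
pose c m := cos (2 * pi * (al * m%:R + ph)).
have e m : (y m - 2^-1) * c m = sawtooth_tail H (y m) * c m
   - \sum_(h < H) sin (2 * pi * h.+1%:R * y m) / (pi * h.+1%:R) * c m.
  by rewrite /sawtooth_tail -mulr_suml -mulrBl addrK.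
under eq_bigr do rewrite -/(c _) e.
rewrite sumrB; apply: (le_trans (ler_normB _ _)).
have hd d : (0 < d <= H)%N ->
    \sum_(1 <= m < l.+1) cos (2 * pi * (d%:R * y m)) <= B.
  move=> dH; have := hB d 0 0 dH.
  rewrite (eq_bigr (fun m => cos (2 * pi * (d%:R * y m)))).
    by apply: le_trans; exact: ler_norm.
  by move=> m _; rewrite mul0r !addr0.
have fejS k : (0 < k <= H)%N ->
  \sum_(1 <= m < l.+1) fejer k (y m) <= k%:R * l%:R + k%:R ^+ 2 * B.
  move=> /andP[k0 kH]; rewrite /fejer exchange_big/=.
  apply: (@le_trans _ _ (\sum_(h < k) (l%:R + k%:R * B))); last first.
    by rewrite sumr_const card_ord -mulr_natl; lra.
  apply: ler_sum => h _; rewrite exchange_big/= (bigD1 h)//=; apply: lerD.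
    under eq_bigr do rewrite subrr mul0r mulr0 cos0.
    by rewrite sumr_const_nat subn1.
  apply: (@le_trans _ _ (\sum_(i < k | i != h) B)).
    apply: ler_sum => i ih.
    have [hi|hi] := ltnP h i.
      rewrite [leLHS](_ : _ = \sum_(1 <= m < l.+1) cos (2 * pi * ((i - h)%:R
        * y m))).
        by apply: hd; have := ltn_ord i; lia.
      by apply: eq_bigr => m _; rewrite natrB ?(ltnW hi)// -[LHS]cosN;
        congr cos; ring.
    have {}hi : (i < h)%N by rewrite ltn_neqAle hi andbT.
    rewrite [leLHS](_ : _ = \sum_(1 <= m < l.+1) cos (2 * pi * ((h - i)%:R * y m))).
      by apply: hd; have := ltn_ord h; lia.
    by apply: eq_bigr => m _; rewrite natrB ?(ltnW hi).
  rewrite big_mkcond/=; apply: (@le_trans _ _ (\sum_(i < k) B)).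
    by apply: ler_sum => i _; case: ifP.
  by rewrite sumr_const card_ord mulr_natl.
have b1 : `|\sum_(1 <= m < l.+1) sawtooth_tail H (y m) * c m| <=
   12 / H%:R * (l%:R + (4 * l%:R * Har + 4 * H%:R * B)).
  apply: (le_trans (ler_norm_sum _ _ _)).
  apply: (@le_trans _ _ (\sum_(1 <= m < l.+1) 12 / H%:R *
      (1 + \sum_(1 <= k < H.+1) 4 / k%:R ^+ 2 * fejer k (y m)))).
    apply: ler_sum => m _; rewrite normrM.
    apply: le_trans (sawtooth_tail_majorant H0 (y01 m)).
    by rewrite ler_piMr// cos_max.
  rewrite -mulr_sumr ler_pM2l ?divr_gt0// big_split/=; apply: lerD.
    by rewrite sumr_const_nat subn1.
  rewrite exchange_big/=.
  have -> : 4 * l%:R * Har + 4 * H%:R * B =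
     \sum_(1 <= k < H.+1) (4 * l%:R * k%:R^-1 + 4 * B).
    by rewrite /Har big_split/= -mulr_sumr sumr_const_nat subn1/= -[(4
      * B) *+ H]mulr_natl; ring.
  apply: ler_sum_nat => k kH.
  rewrite -mulr_sumr.
  have kp : 0 < k%:R :> R by rewrite ltr0n; lia.
  have c0 : 0 < 4 / k%:R ^+ 2 :> R by rewrite divr_gt0// exprn_gt0.
  have h := fejS k ltac:(lia).
  apply: (le_trans (ler_wpM2l (ltW c0) h)).
  by apply: le_of_eq; field; rewrite gt_eqF.
have b2 : `|\sum_(1 <= m < l.+1) \sum_(h < H) sin (2 * pi * h.+1%:R
  * y m) / (pi * h.+1%:R) * c m|
  <= Har * B.
  rewrite exchange_big/= /Har big_add1/= big_mkord mulr_suml.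
  apply: (le_trans (ler_norm_sum _ _ _)); apply: ler_sum => h _.
  have hp : 0 < h.+1%:R :> R by rewrite ltr0n.
  have -> : \sum_(1 <= m < l.+1) sin (2 * pi * h.+1%:R * y m) / (pi * h.+1%:R)
    * c m =
    (2 * pi * h.+1%:R)^-1 * (
      \sum_(1 <= m < l.+1) cos (2 * pi * (h.+1%:R * y m + al * m%:R + (ph - 4^-1)))
    + \sum_(1 <= m < l.+1) cos (2 * pi * (h.+1%:R * y m + (- al) * m%:R + (- ph
      - 4^-1)))).
    rewrite -big_split/= mulr_sumr; apply: eq_bigr => m _.
    set u := 2 * pi * h.+1%:R * y m; set v := 2 * pi * (al * m%:R + ph).
    have -> : 2 * pi * (h.+1%:R * y m + al * m%:R + (ph - 4^-1)) = (u + v) - pi / 2.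
      by rewrite /u /v; field.
    have -> : 2 * pi * (h.+1%:R * y m + (- al) * m%:R + (- ph - 4^-1)) = (u
      - v) - pi / 2.
      by rewrite /u /v; field.
    rewrite !cosBpihalf sinD sinB /c -/v.
    move: (sin u) (cos v) (cos u) (sin v) => su cv cu sv.
    move: (gt_eqF pi0) (gt_eqF hp); move: (pi : R) (h.+1%:R : R) => p n p0 n0.
    by field; rewrite n0 p0.
  rewrite normrM gtr0_norm; last by rewrite invr_gt0 !mulr_gt0.
  have hs := ler_normD
    (\sum_(1 <= m < l.+1) cos (2 * pi * (h.+1%:R * y m + al * m%:R + (ph - 4^-1))))
    (\sum_(1 <= m < l.+1) cos (2 * pi * (h.+1%:R * y m + (- al) * m%:R + (- ph
      - 4^-1)))).
  have h1 := hB h.+1 al (ph - 4^-1) ltac:(have := ltn_ord h; lia).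
  have h2 := hB h.+1 (- al) (- ph - 4^-1) ltac:(have := ltn_ord h; lia).
  apply: (@le_trans _ _ ((2 * pi * h.+1%:R)^-1 * (2 * B))).
    rewrite ler_wpM2l ?invr_ge0 ?mulr_ge0 ?(ltW pi0)//.
    by apply: (le_trans hs); lra.
  have -> : (2 * pi * h.+1%:R)^-1 * (2 * B) = pi^-1 * (h.+1%:R^-1 * B).
    move: (gt_eqF pi0) (gt_eqF hp); move: (pi : R) (h.+1%:R : R) => p n p0 n0.
    by field; rewrite n0 p0.
  rewrite ler_piMl ?mulr_ge0 ?invr_ge0//.
  by rewrite invf_le1//; lra.
apply: (le_trans (lerD b1 b2)).
apply: le_of_eq.
by field; rewrite gt_eqF.
Qed.

End SawtoothSums.

(** * Binomial series coefficients and functions that behave like Gamma *)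

Section BinomialSeries.
Variable R : realType.
Implicit Types (s a b g x : R).

(** The coefficient of z^m in (1 - z)^(-s). *)
Definition binc s (m : nat) : R := \prod_(j < m) ((s + j%:R) / j.+1%:R).

Lemma binc0 s : binc s 0 = 1.
Proof. by rewrite /binc big_ord0. Qed.

Lemma bincS s m : m.+1%:R * binc s m.+1 = (s + m%:R) * binc s m.
Proof.
rewrite /binc big_ord_recr/=.
have m0 : m.+1%:R != 0 :> R by rewrite pnatr_eq0.
by move: (\prod_(_ < _) _) (m.+1%:R : R) m0 => P n n0; field.
Qed.

(** This is (1-z)^(-a) (1-z)^(-b) = (1-z)^(-(a+b)).  In the induction
    k + (n+1-k) = n+1 splits each term in two, which mirrors differentiation of
    the product. *)
Lemma binc_vandermonde a b n :
  \sum_(k < n.+1) binc a k * binc b (n - k) = binc (a + b) n.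
Proof.
elim: n => [|n IH]; first by rewrite big_ord1 !binc0 mulr1.
have n0 : n.+1%:R != 0 :> R by rewrite pnatr_eq0.
apply: (mulfI n0); rewrite bincS -IH !mulr_sumr.
rewrite (eq_bigr (fun k : 'I_n.+2 => k%:R * binc a k * binc b (n.+1 - k)
   + binc a k * ((n.+1 - k)%:R * binc b (n.+1 - k)))); last first.
  move=> k _; have kn : (k <= n.+1)%N by rewrite -ltnS.
  by rewrite -{1}(subnKC kn) natrD; ring.
rewrite big_split/= [X in X + _]big_ord_recl [X in _ + X]big_ord_recr/=.
rewrite subnn !mul0r mulr0 add0r addr0 -big_split/=.
apply: eq_bigr => k _; have kn : (k <= n)%N by rewrite -ltnS.
rewrite /bump/= add1n subSS bincS.
rewrite subSn// bincS.
have -> : n%:R = k%:R + (n - k)%:R :> R by rewrite -natrD subnKC.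
ring.
Qed.

Lemma binc1 n : binc 1 n = 1.
Proof.
rewrite /binc big1// => j _.
by rewrite addrC natr1 mulfV// pnatr_eq0.
Qed.

Lemma binc_sum s n : \sum_(k < n.+1) binc s k = binc (s + 1) n.
Proof.
rewrite -binc_vandermonde; apply: eq_bigr => k _.
by rewrite binc1 mulr1.
Qed.

Lemma binc_ge0 s n : 0 <= s -> 0 <= binc s n.
Proof. by move=> s0; apply: prodr_ge0 => j _; rewrite divr_ge0// addr_ge0. Qed.

Lemma binc_le1 s n : 0 <= s <= 1 -> binc s n <= 1.
Proof.
move=> /andP[s0 s1]; apply: prodr_ile1 => j _.
rewrite divr_ge0 ?addr_ge0//= ler_pdivrMr// mul1r -natr1; lra.
Qed.

(** A log-convex solution of the functional equation of Gamma, normalised at 1.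
    Log-convexity appears only through the last inequality, which controls
    Gamma (x + s) / Gamma x with an explicit error. *)
Definition gamma_like (Gam : R -> R) : Prop :=
  [/\ Gam 1 = 1,
      forall s, 0 < s -> 0 < Gam s,
      forall s, 0 < s -> Gam (s + 1) = s * Gam s &
      forall x s, 0 < x -> 0 <= s <= 1 -> Gam (x + s) <= x `^ s * Gam x].

Section GammaLike.
Variables (Gam : R -> R) (GamP : gamma_like Gam).

Let Gam1 : Gam 1 = 1. Proof. by case: GamP. Qed.
Let Gam_gt0 s : 0 < s -> 0 < Gam s. Proof. by case: GamP => _ h _ _; exact: h. Qed.
Let GamS s : 0 < s -> Gam (s + 1) = s * Gam s.
Proof. by case: GamP => _ _ h _; exact: h. Qed.
Let Gam_shift_le x s : 0 < x -> 0 <= s <= 1 -> Gam (x + s) <= x `^ s * Gam x.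
Proof. by case: GamP => _ _ _ h; exact: h. Qed.

Let Gam_natS n : Gam n.+1%:R = n`!%:R :> R.
Proof.
elim: n => [|n IH]; first by rewrite Gam1.
by rewrite -natr1 GamS// IH factS natrM.
Qed.

Lemma binc_Gamma s m : 0 < s -> binc s m * (Gam s * m`!%:R) = Gam (m%:R + s).
Proof.
move=> s0; elim: m => [|m IH]; first by rewrite binc0 !mul1r fact0 mulr1 add0r.
have -> : m.+1%:R + s = m%:R + s + 1 by rewrite -natr1; ring.
have ms : 0 < m%:R + s by rewrite ltr_wpDl.
rewrite GamS// -IH factS natrM.
have -> : binc s m.+1 * (Gam s * (m.+1%:R * m`!%:R))
  = (m.+1%:R * binc s m.+1) * (Gam s * m`!%:R) by ring.
by rewrite bincS; ring.
Qed.

(** Both inequalities come from log-convexity: the upper one interpolates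
    between m and m + 1, the lower one between m + g and m + g + 1. *)
Lemma binc_between g m : 0 < g <= 1 -> (0 < m)%N ->
  g * m.+1%:R `^ (g - 1) <= Gam (1 + g) * binc g m <= g * m%:R `^ (g - 1).
Proof.
move=> /andP[g0 g1] m0.
have mp : 0 < m%:R :> R by rewrite ltr0n.
have f0 : 0 < m`!%:R :> R by rewrite ltr0n fact_gt0.
have Gg := Gam_gt0 g0.
have e : Gam (1 + g) * binc g m = g * (Gam (m%:R + g) / m`!%:R).
  rewrite addrC GamS// -binc_Gamma//.
  by field; rewrite gt_eqF.
have m1E : m`!%:R = m%:R * Gam m%:R :> R.
  by rewrite -GamS// natr1 Gam_natS.
have Gm := Gam_gt0 mp.
rewrite e; apply/andP; split; rewrite ler_pM2l//.
  rewrite ler_pdivlMr//.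
  have h := @Gam_shift_le (m%:R + g) (1 - g) ltac:(lra) ltac:(lra).
  have e1 : m%:R + g + (1 - g) = m.+1%:R by rewrite -natr1; ring.
  rewrite e1 Gam_natS in h.
  have h1 : (m%:R + g) `^ (1 - g) <= m.+1%:R `^ (1 - g).
    by apply: ge0_ler_powR; rewrite ?nnegrE -?natr1; lra.
  have Gmg : 0 < Gam (m%:R + g) by apply: Gam_gt0; lra.
  have h2 : m`!%:R <= m.+1%:R `^ (1 - g) * Gam (m%:R + g).
    by apply: (le_trans h); rewrite ler_pM2r.
  rewrite -[g - 1]opprB powRN mulrC ler_pdivrMr ?powR_gt0//.
  by rewrite mulrC.
rewrite ler_pdivrMr// m1E mulrA.
apply: (le_trans (Gam_shift_le mp _)); first lra.
rewrite ler_pM2r// -[X in X `^ g](mulr1 m%:R).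
rewrite [leRHS]mulrC mulr_powRB1 ?(ltW mp)// mulr1//.
Qed.

(** The tangents of u^g at u = m and at u = m + 1 lie above the graph. *)
Lemma powR_diff_between g m : 0 < g <= 1 -> (0 < m)%N ->
  g * m.+1%:R `^ (g - 1) <= m.+1%:R `^ g - m%:R `^ g <= g * m%:R `^ (g - 1).
Proof.
move=> /andP[g0 g1] m0.
have : 0 < m%:R :> R by rewrite ltr0n.
rewrite -[m.+1%:R]natr1; move: (m%:R : R) => u u0.
have step (v w : R) : 0 < v -> 0 <= w -> w `^ g <= v `^ g + g * v `^ (g - 1)
  * (w - v).
  move=> v0 w0.
  have h := @powR_tangent R (w / v) g (divr_ge0 w0 (ltW v0)) ltac:(lra).
  have e : w `^ g = v `^ g * (w / v) `^ g.
    rewrite -powRM ?(ltW v0) ?divr_ge0 ?(ltW v0)//.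
    by congr (_ `^ _); field; rewrite gt_eqF.
  have e2 : v `^ g = v * v `^ (g - 1) by rewrite mulr_powRB1 ?ltW.
  have := ler_wpM2l (powR_ge0 v g) h; rewrite -e => {}h; apply: (le_trans h).
  rewrite !e2 le_eqVlt; apply/orP; left; apply/eqP.
  by move: (v `^ (g - 1)) => z; field; rewrite gt_eqF.
have h1 := step u (u + 1) u0 ltac:(lra).
have h2 := step (u + 1) u ltac:(lra) (ltW u0).
apply/andP; split.
  have e : g * (u + 1) `^ (g - 1) * (u - (u + 1)) = - (g * (u + 1) `^ (g - 1))
    by ring.
  by rewrite e in h2; lra.
have e : g * u `^ (g - 1) * (u + 1 - u) = g * u `^ (g - 1) by ring.
by rewrite e in h1; lra.
Qed.

(** For m > 0 both sequences lie between g (m+1)^(g-1) and g m^(g-1), so the sum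
    of the differences telescopes. *)
Lemma binc_powR_diff_sum g n : 0 < g <= 1 ->
  \sum_(0 <= m < n.+1) `| (m.+1%:R `^ g - m%:R `^ g) - Gam (1 + g) * binc g m |
    <= 2.
Proof.
move=> g01; have /andP[g0 g1] := g01.
rewrite big_ltn//.
have -> : (2 : R) = 1 + 1 by [].
apply: lerD.
  rewrite binc0 mulr1 powR1 powR0 ?gt_eqF// subr0.
  have := @Gam_shift_le 1 g ltr01 ltac:(lra).
  rewrite powR1 Gam1 mulr1 => h.
  have : 0 < Gam (1 + g) by apply: Gam_gt0; lra.
  by rewrite ger0_norm; lra.
apply: (@le_trans _ _ (\sum_(1 <= m < n.+1)
   (- (g * m.+1%:R `^ (g - 1)) - - (g * m%:R `^ (g - 1))))).
  apply: ler_sum_nat => m /andP[m0 _].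
  have /andP[h1 h2] := binc_between g01 m0.
  have /andP[h3 h4] := powR_diff_between g01 m0.
  by rewrite ler_norml; apply/andP; split; lra.
rewrite telescope_sumr// opprK powR1 mulr1.
have : 0 <= g * n.+1%:R `^ (g - 1) by rewrite mulr_ge0 ?powR_ge0// ltW.
lra.
Qed.

Lemma binc_sum_le g n : 0 < g <= 1 ->
  Gam (1 + g) * \sum_(k < n.+1) binc g k <= n.+1%:R `^ g.
Proof.
move=> /andP[g0 g1]; rewrite binc_sum.
have f0 : 0 < n`!%:R :> R by rewrite ltr0n fact_gt0.
rewrite [g + 1]addrC.
rewrite -(ler_pM2r f0).
have -> : Gam (1 + g) * binc (1 + g) n * n`!%:R = Gam (n%:R + (1 + g)).
  by rewrite -binc_Gamma; [ring|lra].
have := @Gam_shift_le n.+1%:R g (ltr0Sn _ _) ltac:(lra).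
rewrite Gam_natS; congr (_ <= _).
by congr (Gam _); rewrite -natr1; ring.
Qed.

(** For s = 2 + q two applications of the functional equation reduce the quotient
    Gamma (n+s) / n! to Gamma (n+q) / Gamma n, which log-convexity pins between
    n (n+q)^(q-1) and n^q. *)
Lemma binc_asymptotic s n : 2 < s <= 3 -> (0 < n)%N ->
  `| binc s n - n%:R `^ (s - 1) / Gam s | <= 5 / Gam s * n%:R `^ (s - 2).
Proof.
move=> /andP[s2 s3] n0.
have np : 1 <= n%:R :> R by rewrite ler1n.
have np0 : 0 < n%:R :> R by lra.
have f0 : 0 < n`!%:R :> R by rewrite ltr0n fact_gt0.
have Gs : 0 < Gam s by apply: Gam_gt0; lra.
have h := @binc_Gamma s n ltac:(lra).
pose q := s - 2.
have q01 : 0 <= q <= 1 by rewrite /q; lra.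
have Gn := Gam_gt0 np0.
have nq : 0 < n%:R + q by lra.
have Gq := Gam_gt0 nq.
have e : Gam (n%:R + s) = (n%:R + q + 1) * (n%:R + q) * Gam (n%:R + q).
  have -> : n%:R + s = n%:R + q + 1 + 1 by rewrite /q; ring.
  by rewrite GamS ?GamS//; [ring|lra].
have fE : n`!%:R = n%:R * Gam n%:R :> R.
  by rewrite -GamS// natr1 Gam_natS.
have up := Gam_shift_le np0 q01.
have lo := @Gam_shift_le (n%:R + q) (1 - q) nq ltac:(lra).
have e1 : n%:R + q + (1 - q) = n%:R + 1 :> R by ring.
rewrite e1 GamS// in lo.
have rE : binc s n = (n%:R + q + 1) * (n%:R + q) * (Gam (n%:R + q) / (n%:R
  * Gam n%:R)) / Gam s.
  move: h; rewrite e fE => h.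
  apply: (mulIf (lt0r_neq0 (mulr_gt0 Gs (mulr_gt0 np0 Gn)))).
  by rewrite h; field; rewrite !gt_eqF.
pose w := n%:R `^ q.
have w0 : 0 <= w by apply: powR_ge0.
have w1 : n%:R `^ (s - 1) = n%:R * w.
  by rewrite mulrC -[X in _ * X](powRr1 (ltW np0)) -powRD ?(gt_eqF np0)
    ?implybT//; congr (_ `^ _); rewrite /q; ring.
pose r := Gam (n%:R + q) / (n%:R * Gam n%:R).
have r1 : r <= w / n%:R.
  rewrite /r ler_pdivrMr ?mulr_gt0//; apply: (le_trans up).
  by apply: le_of_eq; rewrite -/w; field; rewrite gt_eqF.
have r2 : w <= (n%:R + q) * r.
  have -> : (n%:R + q) * r = (n%:R + q) * Gam (n%:R + q) / (n%:R * Gam n%:R).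
    by rewrite /r mulrA.
  rewrite ler_pdivlMr ?mulr_gt0//.
  apply: (@le_trans _ _ ((n%:R + q) `^ q * ((n%:R + q) `^ (1 - q) * Gam (n%:R
    + q)))).
    apply: ler_pM => //; first by rewrite mulr_ge0 // ltW.
    by apply: ge0_ler_powR; rewrite ?nnegrE; lra.
  rewrite mulrA -powRD; last by rewrite (gt_eqF nq) implybT.
  have -> : q + (1 - q) = 1 by ring.
  by rewrite powRr1// ltW.
have r0 : 0 <= r by rewrite /r divr_ge0 ?mulr_ge0 ?ltW.
rewrite rE w1 -/r -/w -mulrBl normrM.
rewrite [X in _ * X]gtr0_norm ?invr_gt0//.
have -> : 5 / Gam s * w = 5 * w / Gam s by ring.
rewrite ler_pM2r ?invr_gt0//.
have lower : n%:R * w <= (n%:R + q + 1) * (n%:R + q) * r.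
  by rewrite -mulrA; apply: ler_pM => //; lra.
rewrite ger0_norm; last by rewrite subr_ge0.
have : (n%:R + q + 1) * (n%:R + q) * r <= (n%:R + 2) * (n%:R + 1) * (w / n%:R).
  by apply: ler_pM => //; [rewrite mulr_ge0//; lra|apply: ler_pM; lra].
have -> : (n%:R + 2) * (n%:R + 1) * (w / n%:R) = n%:R * w + 3 * w + 2 * (w / n%:R).
  by field; rewrite gt_eqF.
have : w / n%:R <= w by rewrite ler_piMr// invf_le1.
lra.
Qed.

End GammaLike.
End BinomialSeries.

(** * Euler's integral *)

Section GammaFunction.
Local Open Scope classical_set_scope.
Local Open Scope ring_scope.
Variable R : realType.
Implicit Types (s t x : R).
Notation mu := (@lebesgue_measure R).

Definition gamma_integrand s t : R := t `^ (s - 1) * expR (- t).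
Definition gamma_integral s : \bar R :=
  (\int[mu]_(t in `]0%R, +oo[) (gamma_integrand s t)%:E)%E.
(** The truncation to [1/(n+2), n+2] makes integration by parts available and
    tends to the improper integral by monotone convergence. *)
Definition gamma_truncated s (n : nat) : \bar R :=
  (\int[mu]_(t in `[(n.+2%:R^-1)%R, (n.+2%:R)%R]) (gamma_integrand s t)%:E)%E.

Lemma gamma_integrand_ge0 s t : 0 <= gamma_integrand s t.
Proof. by rewrite mulr_ge0 ?powR_ge0 ?expR_ge0. Qed.

Lemma continuous_powR_pos s t : 0 < t -> {for t, continuous (fun x : R => x `^ s)}.
Proof.
move=> t0; apply: differentiable_continuous; apply/derivable1_diffP.
by apply: derivable_powR; rewrite in_itv/= t0.
Qed.

Lemma continuous_gamma_integrand s t : 0 < t -> {for t, continuous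
  (gamma_integrand s)}.
Proof.
move=> t0; apply: continuousM; first exact: continuous_powR_pos.
apply: continuous_comp; first exact: opp_continuous.
exact: continuous_expR.
Qed.

Lemma measurable_gamma_integrand s : measurable_fun (`]0%R, +oo[%classic : set
  R) (gamma_integrand s).
Proof.
apply: open_continuous_measurable_fun => //.
by move=> t; rewrite inE/= in_itv/= andbT; exact: continuous_gamma_integrand.
Qed.

Lemma cvg_gamma_truncated s : gamma_truncated s n @[n --> \oo] --> gamma_integral s.
Proof.
rewrite /gamma_integral.
have -> : `]0%R, +oo[%classic = \bigcup_n `[(n.+2%:R : R)^-1, n.+2%:R]%classic.
  apply/seteqP; split=> t /=.
    rewrite in_itv/= andbT => t0.
    pose n := maxn (Num.truncn t) (Num.truncn t^-1).
    have tn (x : R) : 0 <= x -> (Num.truncn x <= n)%N -> x <= n.+2%:R.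
      move=> x0 h; have /andP[_ h2] := truncn_itv x0.
      by apply: (le_trans (ltW h2)); rewrite ler_nat; lia.
    exists n => //=; rewrite in_itv/=; apply/andP; split.
      rewrite -[leRHS]invrK lef_pV2 ?posrE ?invr_gt0//.
      by apply: tn; rewrite ?leq_maxr// invr_ge0 ltW.
    by apply: tn; rewrite ?leq_maxl// ltW.
  move=> [n _] /=; rewrite !in_itv/= andbT => /andP[h _].
  by apply: lt_le_trans h; rewrite invr_gt0.
apply: ge0_nondecreasing_set_cvg_integral => //=.
- apply/nondecreasing_seqP => n; rewrite subsetEset => t /=; rewrite !in_itv/=.
  move=> /andP[h1 h2]; apply/andP; split.
    by apply: le_trans h1; rewrite lef_pV2 ?posrE// ler_nat.
  by apply: (le_trans h2); rewrite ler_nat.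
- move=> n; apply/measurable_EFinP.
  apply: measurable_funS (measurable_gamma_integrand s) => // t /=.
  rewrite !in_itv/= andbT => /andP[h _].
  by apply: lt_le_trans h; rewrite invr_gt0.
- by move=> n t _; rewrite lee_fin gamma_integrand_ge0.
Qed.

Lemma gamma_truncated_parts s n : 0 <= s ->
  (gamma_truncated (s + 1) n =
  (n.+2%:R^-1 `^ s * expR (- n.+2%:R^-1) - n.+2%:R `^ s * expR (- n.+2%:R))%:E
  + s%:E * gamma_truncated s n)%E.
Proof.
move=> s0.
set a : R := n.+2%:R^-1; set b : R := n.+2%:R.
have a0 : 0 < a by rewrite invr_gt0.
have ab : a < b.
  apply: (@lt_trans _ _ 1); last by rewrite ltr1n.
  by rewrite invf_lt1 ?ltr1n.
pose F (t : R) := t `^ s; pose f (t : R) := s * t `^ (s - 1).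
pose G (t : R) := - expR (- t); pose g (t : R) := expR (- t).
have dG (t : R) : is_derive t 1 G (g t).
  rewrite /G /g; apply: is_derive_eq.
  by rewrite /GRing.scale/= mulrN1 opprK.
have pos (t : R) : t \in `[a, b] -> 0 < t.
  by rewrite in_itv/= => /andP[h _]; apply: lt_le_trans h.
have cG (t : R) : {for t, continuous G}.
  by apply: differentiable_continuous; apply/derivable1_diffP; have [] := dG t.
have cF (t : R) : 0 < t -> {for t, continuous F} by exact: continuous_powR_pos.
have := @integration_by_parts R F G f g a b ab.
have cf : {within `[a, b], continuous f}.
  apply: continuous_in_subspaceT => t; rewrite inE/= => /pos t0.
  by apply: (@continuousM _ _ (fun=> s) (fun t => t `^ (s - 1)));
    [exact: cst_continuous|exact: continuous_powR_pos].
have cg : {within `[a, b], continuous g}.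
  apply: continuous_subspaceT => t.
  apply: continuous_comp; first exact: opp_continuous.
  exact: continuous_expR.
have dF : derivable_oo_LRcontinuous F a b.
  split.
  - move=> t tab; apply: derivable_powR; rewrite in_itv/= andbT.
    by move: tab; rewrite in_itv/= => /andP[h _]; apply: lt_trans h.
  - by apply: cvg_at_right_filter; exact: cF.
  - by apply: cvg_at_left_filter; apply: cF; apply: lt_trans ab.
have dG' : derivable_oo_LRcontinuous G a b.
  split.
  - by move=> t tab; have [] := dG t.
  - by apply: cvg_at_right_filter; exact: cG.
  - by apply: cvg_at_left_filter; apply: cG.
have Ff : {in `]a, b[, F^`()%classic =1 f}.
  move=> t; rewrite in_itv/= => /andP[h _].
  by rewrite /F powR_derive1// in_itv/= andbT (lt_trans a0).
have Gg : {in `]a, b[, G^`()%classic =1 g}.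
  by move=> t _; rewrite derive1E; have [_ ->] := dG t.
move=> /(_ cf dF Ff cg dG' Gg) H.
rewrite /gamma_truncated -/a -/b.
under eq_integral do rewrite /gamma_integrand addrK.
rewrite [LHS]H.
congr (_ + _)%E.
  by rewrite /F /G; congr EFin; ring.
rewrite -ge0_integralZl//=.
- rewrite -[RHS]oppeK; congr (- _)%E.
  rewrite -integral_ge0N//=.
    by apply: eq_integral => t _; rewrite /f /G /gamma_integrand; congr EFin; ring.
  by move=> t _; rewrite lee_fin mulr_ge0// gamma_integrand_ge0.
- apply/measurable_EFinP.
  apply: measurable_funS (measurable_gamma_integrand s) => // t /=.
  rewrite !in_itv/= andbT => /andP[h _].
  by apply: lt_le_trans h.
- by move=> t _; rewrite lee_fin gamma_integrand_ge0.
Qed.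


Lemma cvg_inv_succ2 : (n.+2%:R^-1 : R) @[n --> \oo] --> 0.
Proof.
apply: (@squeeze_cvgr _ _ _ _ (fun=> 0) (fun n => n.+1%:R^-1)).
- near=> n; rewrite invr_ge0 ler0n/= lef_pV2 ?posrE// ler_nat.
  by [].
- exact: cvg_cst.
- exact: cvg_harmonic.
Unshelve. all: by end_near. Qed.

Lemma cvg_boundary_zero s : 0 < s ->
  (n.+2%:R^-1 `^ s * expR (- n.+2%:R^-1) : R) @[n --> \oo] --> 0.
Proof.
move=> s0.
have h : (n.+2%:R^-1 `^ s : R) @[n --> \oo] --> 0.
  have /cvg_at_rightP H := @powR_cvg0 R s s0.
  apply: (H (fun n => n.+2%:R^-1)); split; last exact: cvg_inv_succ2.
  by move=> n; rewrite invr_gt0.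
apply: (@squeeze_cvgr _ _ _ _ (fun=> 0) (fun n => n.+2%:R^-1 `^ s)) => //.
- near=> n; rewrite mulr_ge0 ?powR_ge0 ?expR_ge0//=.
  by rewrite ler_piMr ?powR_ge0// expR_le1 oppr_le0 invr_ge0.
- exact: cvg_cst.
Unshelve. all: by end_near. Qed.

Lemma cvg_boundary_infty s :
  (n.+2%:R `^ s * expR (- n.+2%:R) : R) @[n --> \oo] --> 0.
Proof.
(* With s <= k + 1, the bound exp x >= x^(k+2) / (k+2)! beats x^s. *)
pose k := Num.truncn `|s|.
have sk : s <= k.+1%:R.
  have /andP[_ h] := truncn_itv (normr_ge0 s).
  by apply: (le_trans (ler_norm s)); exact: ltW.
apply: (@squeeze_cvgr _ _ _ _ (fun=> 0) (fun n => k.+2`!%:R * n.+2%:R^-1)).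
- near=> n; rewrite mulr_ge0 ?powR_ge0 ?expR_ge0//=.
  set x : R := n.+2%:R.
  have x1 : 1 <= x by rewrite ler1n.
  have x0 : 0 < x by lra.
  have xs : x `^ s <= x ^+ k.+1.
    by rewrite -powR_mulrn ?(ltW x0)// ler_powR.
  rewrite expRN ler_pdivrMr ?expR_gt0//; apply: (le_trans xs).
  have := @expR_ge1Dxn R x k.+1 (ltW x0) => h.
  have f0 : 0 < k.+2`!%:R :> R by rewrite ltr0n fact_gt0.
  have h2 : x ^+ k.+2 <= k.+2`!%:R * expR x.
    by rewrite -ler_pdivrMl// mulrC; lra.
  rewrite -(ler_pM2l x0) -exprS; apply: (le_trans h2).
  apply: le_of_eq.
  by move: (k.+2`!%:R : R) (expR x) => A B; field; rewrite gt_eqF.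
- exact: cvg_cst.
- have H : (k.+2`!%:R * n.+2%:R^-1 : R) @[n --> \oo] --> (k.+2`!%:R * 0 : R).
    by apply: cvgM; [exact: cvg_cst|exact: cvg_inv_succ2].
  rewrite mulr0 in H; exact: H.
Unshelve. all: by end_near. Qed.

(** The truncated integrals satisfy the functional equation up to boundary terms
    that vanish in the limit; the identity lives in the extended reals, so that it
    can serve to prove finiteness. *)
Lemma gamma_integralS s : 0 < s ->
  gamma_integral (s + 1) = (s%:E * gamma_integral s)%E.
Proof.
move=> s0.
have h1 := @cvg_gamma_truncated (s + 1).
have h2 : gamma_truncated (s + 1) n @[n --> \oo] --> (s%:E * gamma_integral s)%E.
  under eq_fun do rewrite gamma_truncated_parts ?(ltW s0)//.
  rewrite -(add0e (s%:E * _)%E).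
  apply: cvgeD => //.
    apply: cvg_EFin; first by near=> n.
    have H := cvgB (cvg_boundary_zero s0) (@cvg_boundary_infty s).
    rewrite subr0 in H; exact: H.
  by apply: cvgeZl => //; exact: cvg_gamma_truncated.
exact: (cvg_unique _ h1 h2).
Unshelve. all: by end_near. Qed.

Lemma gamma_integral1 : gamma_integral 1 = 1%E.
Proof.
have h1 := @cvg_gamma_truncated 1.
have h2 : gamma_truncated 1 n @[n --> \oo] --> (1%E : \bar R).
  (* With exponent 0 only the boundary terms of the integration by parts remain. *)
  rewrite -[X in gamma_truncated X](add0r (1:R)).
  under eq_fun do rewrite gamma_truncated_parts// mul0e adde0 !powRr0 !mul1r.
  apply: cvg_EFin; first by near=> n.
  have H1 : (expR (- n.+2%:R^-1) : R) @[n --> \oo] --> (expR (- 0) : R).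
    apply: continuous_cvg; first exact: continuous_expR.
    by apply: cvgN; exact: cvg_inv_succ2.
  have H2 : (expR (- n.+2%:R) : R) @[n --> \oo] --> (0 : R).
    have := @cvg_boundary_infty 0.
    by under eq_fun do rewrite powRr0 mul1r.
  have H3 := cvgB H1 H2.
  rewrite subr0 oppr0 expR0 in H3; exact: H3.
exact: (cvg_unique _ h1 h2).
Unshelve. all: by end_near. Qed.

(** The tangent inequality (t/x)^s <= 1 + s (t/x - 1), integrated against
    t^(x-1) exp(-t). *)
Lemma gamma_integral_le x s : 0 < x -> 0 <= s <= 1 ->
  (gamma_integral (x + s) <= (x `^ s * (s / x))%:E * gamma_integral (x + 1)
    + (x `^ s * (1 - s))%:E * gamma_integral x)%E.
Proof.
move=> x0 s01.
have ms u : measurable_fun (`]0, +oo[%classic : set R) (fun t : R =>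
  (gamma_integrand u t)%:E).
  by apply/measurable_EFinP; exact: measurable_gamma_integrand.
have c1 : 0 <= x `^ s * (s / x) by rewrite !mulr_ge0 ?powR_ge0 ?invr_ge0//; lra.
have c2 : 0 <= x `^ s * (1 - s) by rewrite mulr_ge0 ?powR_ge0//; lra.
have gZ (k u : R) : 0 <= k -> (k%:E * gamma_integral u =
    \int[mu]_(t in `]0%R, +oo[) (k%:E * (gamma_integrand u t)%:E))%E.
  move=> k0; rewrite ge0_integralZl//; [exact: ms|].
  by move=> t _; rewrite lee_fin gamma_integrand_ge0.
rewrite !gZ// -ge0_integralD//; first last.
- by apply: measurable_funeM; exact: ms.
- by move=> t _; rewrite -EFinM lee_fin mulr_ge0// gamma_integrand_ge0.
- by apply: measurable_funeM; exact: ms.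
- by move=> t _; rewrite -EFinM lee_fin mulr_ge0// gamma_integrand_ge0.
apply: ge0_le_integral => //=.
- by move=> t _; rewrite lee_fin gamma_integrand_ge0.
- exact: ms.
- by apply: emeasurable_funD; apply: measurable_funeM; exact: ms.
move=> t; rewrite in_itv/= andbT => t0.
rewrite lee_fin /gamma_integrand.
have e1 : t `^ (x + s - 1) = t `^ (x - 1) * t `^ s.
  by rewrite -powRD ?(gt_eqF t0) ?implybT//; congr (_ `^ _); ring.
have e2 : t `^ (x + 1 - 1) = t `^ (x - 1) * t.
  by rewrite -[X in _ * X](powRr1 (ltW t0)) -powRD ?(gt_eqF t0) ?implybT//;
    congr (_ `^ _); ring.
have e3 : t `^ s = x `^ s * (t / x) `^ s.
  rewrite -powRM ?(ltW x0) ?divr_ge0 ?(ltW x0) ?(ltW t0)//.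
  by congr (_ `^ _); field; rewrite gt_eqF.
have h := @powR_tangent R (t / x) s (divr_ge0 (ltW t0) (ltW x0)) s01.
rewrite e1 e2 e3.
have k0 : 0 <= t `^ (x - 1) * expR (- t) * x `^ s.
  by rewrite !mulr_ge0 ?powR_ge0 ?expR_ge0.
have := ler_wpM2l k0 h.
move: (t `^ (x - 1)) (expR (- t)) (x `^ s) ((t / x) `^ s) => A B C D hh.
have -> : A * (C * D) * B = A * B * C * D by ring.
apply: (le_trans hh); apply: le_of_eq.
by field; rewrite gt_eqF.
Qed.

Lemma gamma_integral_ge0 s : (0 <= gamma_integral s)%E.
Proof. by apply: integral_ge0 => t _; rewrite lee_fin gamma_integrand_ge0. Qed.

(** For 0 < x <= 1 the inequality above at base point 1 bounds the integral at
    1 + x, hence, by the functional equation, the integral at x. *)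
Lemma gamma_integral_fin s : 0 < s -> gamma_integral s \is a fin_num.
Proof.
have small x : 0 < x <= 1 -> gamma_integral x \is a fin_num.
  move=> /andP[x0 x1].
  have h := @gamma_integral_le 1 x ltr01 ltac:(lra).
  have f2 : gamma_integral (1 + 1) = 1%E.
    by rewrite gamma_integralS// gamma_integral1 mul1e.
  rewrite f2 gamma_integral1 [1 + x]addrC gamma_integralS// in h.
  rewrite ge0_fin_numE ?gamma_integral_ge0//.
  rewrite ltNge leye_eq; apply/negP => /eqP e.
  by move: h; rewrite e gt0_muley ?lte_fin// !mule1 -EFinD leye_eq.
have step n : forall x, 0 < x <= n.+1%:R -> gamma_integral x \is a fin_num.
  elim: n => [|n IH] x; first exact: small.
  move=> /andP[x0 xn]; have [x1|x1] := leP x 1; first by apply: small; lra.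
  rewrite -(subrK 1 x) gamma_integralS; last lra.
  by rewrite fin_numM// IH//; move: xn; rewrite -natr1; lra.
move=> s0; apply: (step (Num.truncn s)); rewrite s0/=.
by have /andP[_ h] := truncn_itv (ltW s0); exact: ltW.
Qed.

Lemma GammaE s : 0 < s -> gamma_integral s = (Gamma s)%:E.
Proof. by move=> s0; rewrite /Gamma /Rintegral fineK//;
  exact: gamma_integral_fin. Qed.

Lemma GammaS s : 0 < s -> Gamma (s + 1) = s * Gamma s.
Proof.
move=> s0; apply: EFin_inj; rewrite EFinM -!GammaE//; last lra.
exact: gamma_integralS.
Qed.

Lemma Gamma1 : Gamma 1 = 1 :> R.
Proof. by apply: EFin_inj; rewrite -GammaE// gamma_integral1. Qed.

Lemma Gamma_shift_le x s : 0 < x -> 0 <= s <= 1 ->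
  Gamma (x + s) <= x `^ s * Gamma x.
Proof.
move=> x0 s01; have := gamma_integral_le x0 s01.
rewrite !GammaE; [|lra..]; rewrite -!EFinM -EFinD lee_fin GammaS//.
move/le_trans; apply; apply: le_of_eq.
by field; rewrite gt_eqF.
Qed.

Lemma Gamma_natS n : Gamma n.+1%:R = n`!%:R :> R.
Proof.
elim: n => [|n IH]; first by rewrite Gamma1.
by rewrite -natr1 GammaS// IH factS natrM.
Qed.

(** The shift inequality from x >= 1 to the next integer bounds Gamma x below by a
    factorial divided by a power of x. *)
Lemma Gamma_gt0 s : 0 < s -> 0 < Gamma s.
Proof.
have big x : 1 <= x -> 0 < Gamma x.
  move=> x1; pose n := Num.truncn x.
  have /andP[h1 h2] := truncn_itv (le_trans ler01 x1).
  have := @Gamma_shift_le x (n.+1%:R - x) ltac:(lra).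
  rewrite -natr1 -/n in h2 *.
  move=> /(_ ltac:(lra)); rewrite addrC subrK natr1 Gamma_natS => h.
  have f0 : 0 < n`!%:R :> R by rewrite ltr0n fact_gt0.
  have := lt_le_trans f0 h.
  by rewrite pmulr_rgt0// powR_gt0; lra.
move=> s0; have : 0 < Gamma (s + 1) by apply: big; lra.
by rewrite GammaS// pmulr_rgt0.
Qed.

Lemma gamma_like_Gamma : gamma_like (@Gamma R).
Proof. by split; [exact: Gamma1|exact: Gamma_gt0|exact: GammaS|exact:
  Gamma_shift_le]. Qed.

End GammaFunction.

(** * Ternary convolutions and finite Fourier analysis *)

Section CircleMethod.
Variable R : realType.
Implicit Types (U V W E : nat -> R).

(** After multiplication by 2 sin t, t = pi d / q, the sum telescopes; q steps
    advance the phase by a multiple of 2 pi. *)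
Lemma cos_sum0 (q d : nat) : (0 < d < q)%N ->
  \sum_(j < q) cos (2 * pi * (j%:R / q%:R * d%:R)) = 0 :> R.
Proof.
move=> /andP[d0 dq].
have q0 : 0 < q%:R :> R by rewrite ltr0n; lia.
have dp : 0 < d%:R :> R by rewrite ltr0n.
have dqR : d%:R < q%:R :> R by rewrite ltr_nat.
have pi0 := pi_gt0 R.
pose t : R := pi * d%:R / q%:R.
have t0 : 0 < t by rewrite /t divr_gt0// mulr_gt0.
have tpi : t < pi by rewrite /t ltr_pdivrMr// ltr_pM2l.
have s0 : 0 < sin t by apply: sin_gt0_pi; rewrite t0.
have e j : 2 * sin t * cos (2 * pi * (j%:R / q%:R * d%:R)) =
   sin ((2 * j.+1%:R - 1) * t) - sin ((2 * j%:R - 1) * t).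
  have -> : 2 * pi * (j%:R / q%:R * d%:R) = 2 * j%:R * t by rewrite /t; field;
    rewrite gt_eqF.
  have -> : (2 * j.+1%:R - 1) * t = 2 * j%:R * t + t by rewrite -natr1; ring.
  have -> : (2 * j%:R - 1) * t = 2 * j%:R * t - t by ring.
  by rewrite sinD sinB; ring.
apply: (mulfI (lt0r_neq0 (mulr_gt0 (ltr0n R 2) s0))).
rewrite mulr0 mulr_sumr.
under eq_bigr do rewrite e.
rewrite -(big_mkord xpredT (fun j => sin ((2 * j.+1%:R - 1) * t) - sin ((2
  * j%:R - 1) * t))).
rewrite telescope_sumr//.
have -> : (2 * q%:R - 1) * t = - t + (pi *+ 2) *+ d.
  by rewrite -[_ *+ d]mulr_natr -[pi *+ 2]mulr_natr /t; field; rewrite gt_eqF.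
rewrite (periodicn (@sinD2pi R)).
by rewrite mulr0 sub0r mulN1r subrr.
Qed.

Lemma cos_orthogonality (q M N : nat) : (M < N + q)%N -> (N < M + q)%N ->
  \sum_(j < q) cos (2 * pi * (j%:R / q%:R * (M%:R - N%:R))) = q%:R
    * (M == N)%:R :> R.
Proof.
move=> h1 h2; have [->|MN] := eqVneq M N.
  under eq_bigr do rewrite subrr !mulr0 cos0.
  by rewrite sumr_const card_ord mulr1.
rewrite mulr0; have [h|h] := ltnP M N.
  rewrite -[RHS](@cos_sum0 q (N - M)); last lia.
  apply: eq_bigr => j _; rewrite natrB; last exact: ltnW.
  by rewrite -cosN; congr cos; ring.
rewrite -[RHS](@cos_sum0 q (M - N)); last lia.
by apply: eq_bigr => j _; rewrite natrB.
Qed.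

Lemma parseval U (l : nat) :
  \sum_(j < 2 * l + 1)
    ((\sum_(b < l.+1) U b * cos (2 * pi * (j%:R / (2 * l + 1)%:R * b%:R))) ^+ 2
   + (\sum_(b < l.+1) U b * sin (2 * pi * (j%:R / (2 * l + 1)%:R * b%:R))) ^+ 2)
  = (2 * l + 1)%:R * \sum_(b < l.+1) U b ^+ 2.
Proof.
set q := (2 * l + 1)%N.
transitivity (\sum_(j < q) \sum_(b < l.+1) \sum_(d < l.+1)
   U b * U d * cos (2 * pi * (j%:R / q%:R * (b%:R - d%:R)))).
  apply: eq_bigr => j _.
  rewrite !expr2 !big_distrlr/= -big_split/=; apply: eq_bigr => b _.
  rewrite -big_split/=; apply: eq_bigr => d _.
  have -> : 2 * pi * (j%:R / q%:R * (b%:R - d%:R)) = 2 * pi * (j%:R / q%:R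
    * b%:R) - 2 * pi * (j%:R / q%:R * d%:R) :> R by ring.
  by rewrite cosB; ring.
rewrite exchange_big/= mulr_sumr; apply: eq_bigr => b _.
rewrite exchange_big/= (bigD1 b)//= [X in _ + X]big1 ?addr0.
  rewrite -mulr_sumr cos_orthogonality ?eqxx; [|have := ltn_ord b; lia..].
  by rewrite mulr1 expr2 mulrC.
move=> d db; rewrite -mulr_sumr cos_orthogonality; [|have := ltn_ord b;
  have := ltn_ord d; lia..].
have -> : (b == d :> nat) = false by rewrite eq_sym; exact: negbTE.
by rewrite !mulr0.
Qed.

(** The coefficient of z^l in the product of the three generating series. *)
Definition conv3 U V W (l : nat) : R :=
  \sum_(a < l.+1) \sum_(b < l.+1) \sum_(d < l.+1)
    (a + b + d == l)%N%:R * (U a * V b * W d).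

Lemma conv3_rot U V W l : conv3 U V W l = conv3 W U V l.
Proof.
rewrite /conv3.
under eq_bigr do rewrite exchange_big/=.
rewrite exchange_big/=; apply: eq_bigr => d _; apply: eq_bigr => a _.
by apply: eq_bigr => b _; rewrite [(d + a + b)%N](_ : _ = (a + b + d)%N);
  [ring|lia].
Qed.

Lemma conv3_subl U U' V W l :
  conv3 U V W l - conv3 U' V W l = conv3 (fun m => U m - U' m) V W l.
Proof.
rewrite /conv3 -sumrB; apply: eq_bigr => a _.
rewrite -sumrB; apply: eq_bigr => b _; rewrite -sumrB; apply: eq_bigr => d _.
by ring.
Qed.

(** The telescoping of a^3 - b^3, in a commutative convolution algebra. *)
Lemma conv3_diff F G l :
  conv3 F F F l - conv3 G G G l =
    conv3 (fun m => F m - G m) F F l + conv3 (fun m => F m - G m) F G l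
  + conv3 (fun m => F m - G m) G G l.
Proof.
rewrite -!conv3_subl.
rewrite (conv3_rot F F G) (conv3_rot F G G); ring.
Qed.

(** Orthogonality modulo q = 2 l + 1 turns q times the convolution into a sum over
    q frequencies of products of three trigonometric sums; q exceeds every
    |a + b + d - l| that occurs, so no wrap-around takes place.  The sum of E is
    bounded by B in every phase, and Parseval evaluates the mean squares of the
    other two. *)
Lemma conv3_bound E U V (l : nat) (B : R) :
  (forall al ph, `|\sum_(a < l.+1) E a * cos (2 * pi * (al * a%:R + ph))| <= B) ->
  `|conv3 E U V l| <= B * (\sum_(b < l.+1) U b ^+ 2 + \sum_(b < l.+1) V b ^+ 2).
Proof.
move=> hB; set q := (2 * l + 1)%N.
have q0 : 0 < q%:R :> R by rewrite ltr0n /q addn1.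
pose th (j : nat) (x : R) := 2 * pi * (j%:R / q%:R * x).
pose Cc U j := \sum_(b < l.+1) U b * cos (th j b%:R).
pose Ss U j := \sum_(b < l.+1) U b * sin (th j b%:R).
pose Ec j := \sum_(a < l.+1) E a * cos (th j (a%:R - l%:R)).
pose Es j := \sum_(a < l.+1) E a * sin (th j (a%:R - l%:R)).
have hEc j : `|Ec j| <= B.
  have := hB (j%:R / q%:R) (- (j%:R / q%:R * l%:R)); rewrite /Ec.
  congr (`|_| <= _); apply: eq_bigr => a _; rewrite /th; congr (_ * cos _); ring.
(* A sine is a cosine shifted by a quarter of a turn. *)
have hEs j : `|Es j| <= B.
  have := hB (j%:R / q%:R) (- (j%:R / q%:R * l%:R) - 4^-1); rewrite /Es.
  congr (`|_| <= _); apply: eq_bigr => a _; rewrite /th -cosBpihalf; congr (_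
    * cos _); field.
  by rewrite gt_eqF.
have e : q%:R * conv3 E U V l = \sum_(j < q)
   (Ec j * (Cc U j * Cc V j - Ss U j * Ss V j) - Es j * (Ss U j * Cc V j
     + Cc U j * Ss V j)).
  transitivity (\sum_(j < q) \sum_(a < l.+1) \sum_(b < l.+1) \sum_(d < l.+1)
     E a * U b * V d * cos (th j ((a + b + d)%N%:R - l%:R))).
    rewrite [RHS]exchange_big/= /conv3 mulr_sumr; apply: eq_bigr => a _.
    rewrite [RHS]exchange_big/= mulr_sumr; apply: eq_bigr => b _.
    rewrite [RHS]exchange_big/= mulr_sumr; apply: eq_bigr => d _.
    rewrite -mulr_sumr cos_orthogonality; first by ring.
      by have := ltn_ord a; have := ltn_ord b; have := ltn_ord d; lia.
    by have := ltn_ord a; have := ltn_ord b; have := ltn_ord d; lia.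
  apply: eq_bigr => j _.
  rewrite /Cc /Ss !big_distrlr/= -sumrB -big_split/=.
  rewrite /Ec /Es !mulr_suml -sumrB; apply: eq_bigr => a _.
  rewrite !mulr_sumr -sumrB; apply: eq_bigr => b _.
  rewrite -sumrB -big_split/= !mulr_sumr -sumrB; apply: eq_bigr => d _.
  have -> : th j ((a + b + d)%N%:R - l%:R) = th j (a%:R - l%:R) + (th j b%:R
    + th j d%:R).
    by rewrite /th !natrD; ring.
  by rewrite !cosD sinD; ring.
have pt j : `|Ec j * (Cc U j * Cc V j - Ss U j * Ss V j) - Es j * (Ss U j
  * Cc V j + Cc U j * Ss V j)|
  <= B * ((Cc U j ^+ 2 + Ss U j ^+ 2) + (Cc V j ^+ 2 + Ss V j ^+ 2)).
  have am (x y z w : R) : `|x * y| + `|z * w| <= (x ^+ 2 + y ^+ 2 + z ^+ 2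
    + w ^+ 2) / 2.
    have am2 (u v : R) : `|u * v| <= (u ^+ 2 + v ^+ 2) / 2.
      rewrite normrM -(real_normK (num_real u)) -(real_normK (num_real v)).
      have := sqr_ge0 (`|u| - `|v|); rewrite sqrrB; lra.
    by have := am2 x y; have := am2 z w; lra.
  apply: (le_trans (ler_normB _ _)); rewrite !normrM.
  have h1 : `|Cc U j * Cc V j - Ss U j * Ss V j| <= ((Cc U j ^+ 2
    + Ss U j ^+ 2) + (Cc V j ^+ 2 + Ss V j ^+ 2)) / 2.
    by apply: (le_trans (ler_normB _ _)); have := am (Cc U j) (Cc V j) (Ss U j)
      (Ss V j); lra.
  have h2 : `|Ss U j * Cc V j + Cc U j * Ss V j| <= ((Cc U j ^+ 2
    + Ss U j ^+ 2) + (Cc V j ^+ 2 + Ss V j ^+ 2)) / 2.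
    by apply: (le_trans (ler_normD _ _)); have := am (Ss U j) (Cc V j) (Cc U j)
      (Ss V j); lra.
  have := ler_pM (normr_ge0 _) (normr_ge0 _) (hEc j) h1.
  have := ler_pM (normr_ge0 _) (normr_ge0 _) (hEs j) h2.
  lra.
rewrite -(ler_pM2l q0) -[q%:R in leLHS]gtr0_norm// -normrM e.
apply: (le_trans (ler_norm_sum _ _ _)).
apply: (@le_trans _ _ (\sum_(j < q)
    B * ((Cc U j ^+ 2 + Ss U j ^+ 2) + (Cc V j ^+ 2 + Ss V j ^+ 2)))).
  by apply: ler_sum => j _; exact: pt.
rewrite -mulr_sumr big_split/= !parseval -/q.
by apply: le_of_eq; ring.
Qed.

Lemma conv3E U V W l : conv3 U V W l =
  \sum_(a < l.+1) U a * \sum_(b < (l - a).+1) V b * W (l - a - b)%N.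
Proof.
apply: eq_bigr => a _; rewrite mulr_sumr.
have al : (l - a < l.+1)%N by rewrite ltnS leq_subr.
rewrite (big_ord_widen l.+1 (fun b => U a * (V b * W (l - a - b)%N)) al).
rewrite [RHS]big_mkcond/=; apply: eq_bigr => b _.
have al2 := ltn_ord a.
case: ifPn => hb.
  have lab : (l - a - b < l.+1)%N by lia.
  rewrite (bigD1 (Ordinal lab))//= big1 ?addr0.
    have -> : (a + b + (l - a - b) == l)%N by lia.
    by rewrite mul1r mulrA.
  move=> d dn; have -> : (a + b + d == l)%N = false; last by rewrite mul0r.
  apply/negP => /eqP h; move/negP: dn; apply; apply/eqP/val_inj => /=; lia.
rewrite big1// => d _; have -> : (a + b + d == l)%N = false; last by rewrite mul0r.
by apply/negP => /eqP h; move/negP: hb; apply; lia.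
Qed.

Lemma conv3_rbin (k s : R) l :
  let G m := k * binc s m in conv3 G G G l = k ^+ 3 * binc (3 * s) l.
Proof.
move=> G; rewrite conv3E.
have -> : 3 * s = s + (s + s) by ring.
rewrite -binc_vandermonde mulr_sumr; apply: eq_bigr => a _.
rewrite -binc_vandermonde /G !mulr_sumr; apply: eq_bigr => b _.
ring.
Qed.

End CircleMethod.

(** * Counting representations by a ternary convolution *)

Section Counting.
Variable R : realType.

Definition ceil_pow (g : R) (m : nat) : nat := `|Num.ceil (m%:R `^ g : R)|%N.

Lemma ceil_powE g m : (ceil_pow g m)%:Z = Num.ceil (m%:R `^ g : R).
Proof. by rewrite /ceil_pow gez0_abs// ceil_ge0 (lt_le_trans _ (powR_ge0 _
  _))// ltrN10. Qed.

Lemma ltn_ceil_pow g m n : (n < ceil_pow g m)%N = (n%:R < m%:R `^ g :> R).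
Proof. by rewrite -ltz_nat ceil_powE ceil_gt_int. Qed.

Lemma ceil_pow_itv g m : 0 <= (ceil_pow g m)%:R - m%:R `^ g < 1.
Proof.
have := ceil_itv (m%:R `^ g : R); rewrite -ceil_powE intrB -!pmulrn => /andP[h1 h2].
by apply/andP; split; lra.
Qed.

Lemma ceil_pow0 g : g != 0 -> ceil_pow g 0 = 0%N.
Proof. by move=> g0; rewrite /ceil_pow powR0// ceil0. Qed.

Lemma ceil_pow1 g : ceil_pow g 1 = 1%N.
Proof. by rewrite /ceil_pow powR1 ceil1. Qed.

Lemma leq_ceil_pow g m n : 0 <= g -> (m <= n)%N -> (ceil_pow g m <= ceil_pow g n)%N.
Proof.
move=> g0 mn; rewrite -lez_nat !ceil_powE; apply: le_ceil.
by apply: ge0_ler_powR; rewrite ?nnegrE ?ler_nat.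
Qed.

(** For g <= 1 the function u^g grows by at most 1 over a unit step. *)
Lemma ceil_powS g m : 0 < g <= 1 -> (ceil_pow g m.+1 <= (ceil_pow g m).+1)%N.
Proof.
move=> g01; have /andP[g0 g1] := g01.
have [->|m0] := posnP m; first by rewrite ceil_pow1.
rewrite -lez_nat ceil_powE ceil_le_int -pmulrn -[(ceil_pow g m).+1%:R]natr1.
have /andP[h _] := ceil_pow_itv g m.
have /andP[_ h2] := @powR_diff_between R g m g01 m0.
have m1 : 1 <= m%:R :> R by rewrite ler1n.
have : m%:R `^ (g - 1) <= 1 :> R.
  by rewrite -[leRHS](powRr0 m%:R) ler_powR//; lra.
have p0 : 0 <= m%:R `^ (g - 1) :> R by apply: powR_ge0.
move=> p1; have : g * m%:R `^ (g - 1) <= 1 * 1 by apply: ler_pM => //; lra.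
lra.
Qed.

Lemma ceil_pow_le g m : 0 < g <= 1 -> (ceil_pow g m <= m)%N.
Proof.
move=> g01; elim: m => [|m IH]; first by rewrite ceil_pow0// gt_eqF//; lra.
by apply: leq_trans (ceil_powS m g01) _; rewrite ltnS.
Qed.

(** The number of integers x with floor (|x|^(1/g)) = m.  The difference of
    ceilings counts the x >= 0, and x = 0, which falls in the fibre of 0, must
    not be counted twice. *)
Definition floor_fibre (g : R) (m : nat) : R :=
  2 * ((ceil_pow g m.+1)%:R - (ceil_pow g m)%:R) - (m == 0%N)%:R.

Lemma floor_pow_lt (c : R) (n m : nat) : 0 < c ->
  (floor_pow c n%:Z < m%:Z) = (n < ceil_pow c^-1 m)%N.
Proof.
move=> c0; rewrite ltn_ceil_pow /floor_pow floor_lt_int -!pmulrn.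
have -> : (m%:R : R) = (m%:R `^ c^-1) `^ c.
  by rewrite -powRrM mulVf ?gt_eqF// powRr1.
rewrite -powRrM mulVf ?gt_eqF// powRr1//.
apply/idP/idP => h; last first.
  have := gt0_ltr_powR c0 _ _ h; rewrite -powRrM mulVf ?gt_eqF// powRr1//.
  by apply; rewrite ?nnegrE ?powR_ge0.
rewrite ltNge; apply/negP => h2.
have := ge0_ler_powR (ltW c0) _ _ h2; rewrite -powRrM mulVf ?gt_eqF// powRr1//.
rewrite !nnegrE powR_ge0 ler0n => /(_ isT isT) h3.
by have := lt_le_trans h h3; rewrite ltxx.
Qed.

Lemma sum_lt_const (n k : nat) : (k <= n)%N -> \sum_(i < n) (i < k)%N%:R
  = k%:R :> R.
Proof.
move=> kn; rewrite -(big_mkord xpredT (fun i => (i < k)%N%:R)).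
rewrite (@big_cat_nat _ _ _ k)//=.
rewrite (eq_big_nat _ _ (F2 := fun=> 1)); last by move=> i /andP[_ ->].
rewrite sumr_const_nat subn0 [X in _ + X]big_nat big1 ?addr0//.
by move=> i /andP[ki _]; rewrite ltnNge ki.
Qed.

Definition sym_range (l : nat) : seq int :=
  [seq Posz n | n <- iota 0 l.+1] ++ [seq - Posz n | n <- iota 1 l].

Lemma sum_sym_range (c : R) (l : nat) (phi : nat -> R) : 1 <= c ->
  (forall m, (l < m)%N -> phi m = 0) ->
  \sum_(x <- sym_range l) phi `|floor_pow c x|%N =
  \sum_(m < l.+1) floor_fibre c^-1 m * phi m.
Proof.
move=> c1 phi0; have c0 : 0 < c by lra.
have g01 : 0 < c^-1 <= 1 by rewrite invr_gt0 c0 invf_le1.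
pose N (n : nat) := `|floor_pow c n%:Z|%N.
have NE (n : nat) : (N n)%:Z = floor_pow c n by rewrite /N gez0_abs// floor_pow_ge0.
have Nlt n m : (N n < m)%N = (n < ceil_pow c^-1 m)%N.
  by rewrite -ltz_nat NE floor_pow_lt.
have N0 : N 0%N = 0%N.
  by apply/eqP; rewrite -leqn0 -ltnS Nlt ceil_pow1.
have key : \sum_(n < l.+1) phi (N n) =
   \sum_(m < l.+1) ((ceil_pow c^-1 m.+1)%:R - (ceil_pow c^-1 m)%:R) * phi m.
  transitivity (\sum_(n < l.+1) \sum_(m < l.+1) (N n == m)%:R * phi m).
    apply: eq_bigr => n _; have [h|h] := ltnP l (N n).
      rewrite phi0// big1// => m _.
      have -> : (N n == m) = false by apply/eqP => e; have := ltn_ord m; lia.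
      by rewrite mul0r.
    rewrite (bigD1 (Ordinal (h : (N n < l.+1)%N)))//= eqxx mul1r big1 ?addr0//
      => m mn.
    have -> : (N n == m) = false; last by rewrite mul0r.
    by apply: contraNF mn => /eqP e; apply/eqP/val_inj.
  rewrite exchange_big/=; apply: eq_bigr => m _; rewrite -mulr_suml; congr (_ * _).
  transitivity (\sum_(n < l.+1) ((n < ceil_pow c^-1 m.+1)%N%:R - (n < ceil_pow
    c^-1 m)%N%:R : R)).
    apply: eq_bigr => n _; rewrite -!Nlt ltnS.
    by case: ltngtP; rewrite ?subrr ?subr0 ?sub0r.
  rewrite sumrB !sum_lt_const//.
    by apply: leq_trans (ceil_pow_le m g01) _; rewrite ltnW.
  by apply: leq_trans (ceil_pow_le m.+1 g01) _.
rewrite /sym_range big_cat !big_map.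
have e1 : \sum_(j <- iota 0 l.+1) phi `|floor_pow c j|%N = \sum_(n < l.+1) phi
  (N n).
  by rewrite -[iota 0 l.+1]/(index_iota 0 l.+1) big_mkord.
have e2 : \sum_(j <- iota 1 l) phi `|floor_pow c (- j%:Z)|%N = \sum_(n < l.+1)
  phi (N n) - phi 0%N.
  rewrite big_ord_recl N0 addrC addKr -(big_mkord xpredT (fun i => phi (N i.+1))).
  have -> : iota 1 l = index_iota 1 l.+1 by rewrite /index_iota subn1.
  rewrite big_add1/=.
  by apply: eq_bigr => n _; rewrite /floor_pow normrN.
rewrite e1 e2 key big_ord_recl [X in _ = X]big_ord_recl.
under [X in _ = _ + X]eq_bigr do rewrite /floor_fibre /= subr0 -mulrA.
rewrite -mulr_sumr /floor_fibre/=; ring.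
Qed.

(** All solutions have coordinates of absolute value at most l, so the count is a
    triple sum over this range, and each of the three sums is regrouped by the
    value of the floor. *)
Lemma rep_count_conv3 (c : R) (l : nat) : 1 <= c ->
  (rep_count c l)%:R = conv3 (floor_fibre c^-1) (floor_fibre c^-1) (floor_fibre
    c^-1) l.
Proof.
move=> c1; pose s := sym_range l.
pose N (x : int) := `|floor_pow c x|%N.
have NE x : (N x)%:Z = floor_pow c x by rewrite /N gez0_abs// floor_pow_ge0.
have sU : uniq s.
  rewrite /s /sym_range cat_uniq !map_inj_uniq ?iota_uniq//; last first.
  - by move=> m n [].
  - by move=> m n /oppr_inj [].
  rewrite andTb andbT; apply/hasPn => x /mapP[n]; rewrite mem_iota => /andP[n0
    _] ->.
  apply/negP => /mapP[m _] h.
  have : (0 <= - n%:Z)%R by rewrite h.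
  by rewrite oppr_ge0 lez_nat leqn0 => /eqP nz; rewrite nz in n0.
have sP (x : int) : (N x <= l)%N -> x \in s.
  move=> xl; have xl2 : (`|x|%N <= l)%N.
    apply: leq_trans xl; rewrite -lez_nat NE abszE; exact: floor_pow_ge.
  rewrite mem_cat; case: x xl xl2 => n _ nl; apply/orP; [left|right].
    by apply/mapP; exists n => //; rewrite mem_iota leq0n add0n ltnS.
  by apply/mapP; exists n.+1; [rewrite mem_iota add1n; lia|rewrite NegzE].
pose P (t : int * int * int) := (N t.1.1 + N t.1.2 + N t.2 == l)%N.
pose s3 := [seq (x, z) | x <- [seq (a, b) | a <- s, b <- s], z <- s].
have e : rep_count c l = count P s3.
  rewrite /rep_count -size_filter; apply: perm_size; apply: uniq_perm.
  - exact: fset_uniq.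
  - by rewrite filter_uniq// !allpairs_uniq// => -[? ?] [? ?].
  move=> [[a b] d]; rewrite in_fset_set; last exact: rep_set_finite.
  rewrite mem_filter.
  have setE : ((a, b, d) \in rep_set c l) = P (a, b, d).
    rewrite /P/=; apply/idP/idP.
      by rewrite inE /rep_set/= -!NE -!PoszD => -[->].
    by move=> /eqP h; rewrite inE /rep_set/= -!NE -!PoszD h.
  rewrite setE; case: (boolP (P (a, b, d))) => //= h; apply/esym.
  have hl : (N a + N b + N d)%N = l by apply/eqP.
  have [Na Nb Nd] : [/\ N a <= l, N b <= l & N d <= l]%N by split; lia.
  apply/allpairsP; exists ((a, b), d); split=> //; last exact: sP.
  by apply/allpairsP; exists (a, b); split=> //; exact: sP.
rewrite e -sum1_count natr_sum big_mkcond/= big_allpairs big_allpairs.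
rewrite /P/=.
pose F := floor_fibre c^-1.
have inner i j : (\sum_(z <- s) (if (i + j + N z == l)%N then 1 else 0) =
   \sum_(k < l.+1) F k * (i + j + k == l)%N%:R :> R).
  rewrite -(@sum_sym_range c l (fun k => (i + j + k == l)%N%:R))//.
    by apply: eq_bigr => z _; rewrite -/(N z); case: ifP.
  move=> m lm; have -> // : (i + j + m == l)%N = false.
  by apply/eqP; lia.
under eq_bigr do under eq_bigr do rewrite inner.
have middle i : \sum_(y <- s) \sum_(k < l.+1) F k * (i + N y + k == l)%N%:R =
   \sum_(j < l.+1) F j * \sum_(k < l.+1) F k * (i + j + k == l)%N%:R.
  rewrite -(@sum_sym_range c l (fun j => \sum_(k < l.+1) F k * (i + j
    + k == l)%N%:R))//.
  move=> m lm; rewrite big1// => k _; have -> : (i + m + k == l)%N = false.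
    by apply/eqP; lia.
  by rewrite mulr0.
under eq_bigr do rewrite middle.
rewrite (@sum_sym_range c l (fun i => \sum_(j < l.+1) F j * \sum_(k < l.+1) F k
  * (i + j + k == l)%N%:R))//; last first.
  move=> m lm; rewrite big1// => j _; rewrite big1 ?mulr0// => k _.
  have -> : (m + j + k == l)%N = false by apply/eqP; lia.
  by rewrite mulr0.
rewrite /conv3; apply: eq_bigr => i _; rewrite mulr_sumr; apply: eq_bigr => j _.
rewrite !mulr_sumr; apply: eq_bigr => k _; rewrite -/F; ring.
Qed.

Lemma floor_fibre_sqr g m : 0 < g <= 1 ->
  floor_fibre g m ^+ 2 <= 4 * ((ceil_pow g m.+1)%:R - (ceil_pow g m)%:R).
Proof.
move=> g01; rewrite /floor_fibre.
have [->|m0] := posnP m.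
  by rewrite ceil_pow1 ceil_pow0 ?gt_eqF//=; lra.
rewrite subr0.
have h1 := ceil_powS m g01; have h2 := @leq_ceil_pow g m m.+1 ltac:(lra) (leqnSn m).
have [->|->] : ceil_pow g m.+1 = ceil_pow g m \/ ceil_pow g m.+1
  = (ceil_pow g m).+1 by lia.
  by rewrite subrr; lra.
rewrite -[(ceil_pow g m).+1%:R]natr1; lra.
Qed.

(** The fibres have at most two elements, so the sum of squares is controlled by
    the number of integers in a range of length of order l^g. *)
Lemma floor_fibre_sqr_sum g l : 0 < g <= 1 -> (0 < l)%N ->
  \sum_(m < l.+1) floor_fibre g m ^+ 2 <= 12 * l%:R `^ g.
Proof.
move=> g01 l0; have /andP[g0 g1] := g01.
apply: (@le_trans _ _ (\sum_(m < l.+1) 4 * ((ceil_pow g m.+1)%:R - (ceil_pow g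
  m)%:R))).
  by apply: ler_sum => m _; exact: floor_fibre_sqr.
rewrite -mulr_sumr -(big_mkord xpredT (fun m => (ceil_pow g m.+1)%:R
  - (ceil_pow g m)%:R)).
rewrite telescope_sumr// ceil_pow0 ?gt_eqF// subr0.
have : (ceil_pow g l.+1)%:R <= (ceil_pow g l)%:R + 1 :> R.
  by rewrite natr1 ler_nat ceil_powS.
have /andP[_ h] := ceil_pow_itv g l.
have : 1 <= l%:R `^ g by rewrite -[leLHS](powRr0 l%:R) ler_powR ?ler1n// ltW.
lra.
Qed.

End Counting.

(** * Comparison of the two ternary convolutions *)

Section Assembly.
Variable R : realType.
Implicit Types (g al ph : R) (l m : nat).

(** Since ceil (m^g) is an integer, the phase h (ceil (m^g) - m^g) may be replaced
    by - h m^g, to which the second derivative test applies.  The truncation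
    point is H = floor (l^(g/3)). *)
Lemma twisted_ceil_sum g l al ph : 1/2 <= g < 1 -> (0 < l)%N ->
  `| \sum_(1 <= m < l.+1) ((ceil_pow g m)%:R - m%:R `^ g - 2^-1) *
       cos (2 * pi * (al * m%:R + ph)) |
  <= (53 * (24 / Num.sqrt (1 - g)) + 504) * l%:R `^ (1 - g / 4).
Proof.
move=> g01 l0; have /andP[g0 g1] := g01.
set K := 24 / Num.sqrt (1 - g).
have K0 : 0 <= K by rewrite divr_ge0// sqrtr_ge0.
have l1 : 1 <= l%:R :> R by rewrite ler1n.
have lp : 0 < l%:R :> R by lra.
have pD (a b : R) : l%:R `^ (a + b) = l%:R `^ a * l%:R `^ b.
  by apply: powRD; rewrite (gt_eqF lp) implybT.
have p1 (a : R) : 0 <= a -> 1 <= l%:R `^ a.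
  by move=> a0; rewrite -[leLHS](powRr0 l%:R) ler_powR.
pose X := l%:R `^ (g / 3); pose H := Num.truncn X.
have X1 : 1 <= X by apply: p1; lra.
have /andP[HX XH] := truncn_itv (le_trans ler01 X1).
rewrite -/H -natr1 in HX XH.
have H0 : (0 < H)%N by rewrite truncn_gt0.
have H1 : 1 <= H%:R :> R by rewrite ler1n.
have Hl : (H <= l)%N.
  rewrite -(ler_nat R); apply: (le_trans HX).
  by apply: ler1_powR => //; lra.
pose Y := l%:R `^ (1 - g / 3); pose Z := l%:R `^ (g / 12).
have Y0 : 0 <= Y by apply: powR_ge0.
have Z1 : 1 <= Z by apply: p1; lra.
have ZY : l%:R `^ (1 - g / 4) = Z * Y by rewrite /Z /Y -pD; congr (_ `^ _); field.
have lH : l%:R / H%:R <= 2 * Y.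
  rewrite ler_pdivrMr; last lra.
  have -> : l%:R = Y * X by rewrite /Y /X -pD subrK powRr1// ltW.
  have : Y * X <= Y * (2 * H%:R) by apply: ler_wpM2l => //; lra.
  lra.
have Har : \sum_(1 <= k < H.+1) (k%:R^-1 : R) <= 5 * Z.
  apply: (le_trans (harmonic_le_powR R H0)); rewrite ler_pM2l//.
  have -> : Z = X `^ 4^-1 by rewrite /Z /X -powRrM; congr (_ `^ _); field.
  by apply: ge0_ler_powR; rewrite ?nnegrE ?invr_ge0//; lra.
have := @weighted_sawtooth_sum R (fun m => (ceil_pow g m)%:R - m%:R `^ g) l H
  (K * Y) al ph H0
  (ceil_pow_itv g).
move=> W; apply: (le_trans (W _)).
  move=> h a p /andP[h0 hH].
  rewrite (eq_bigr (fun m : nat => cos (2 * pi * (h%:R * m%:R `^ g + (- a)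
    * m%:R + (- p))))); last first.
    move=> m _; rewrite -[RHS]cosN -mulrN.
    rewrite -(cos_turnDz _ (- (h%:Z * (ceil_pow g m)%:Z))) mulrNz intrM -!pmulrn.
    by congr (cos (_ * _)); ring.
  apply: (le_trans (@powR_phase_sum R g (- a) (- p) h l g01 _)); first
    by rewrite h0 (leq_trans hH).
  rewrite -/K; apply: ler_wpM2l => //.
  have -> : Y = l%:R `^ (g / 6) * l%:R `^ (1 - g / 2).
    by rewrite /Y -pD; congr (_ `^ _); field.
  apply: ler_wpM2r; first exact: powR_ge0.
  have -> : l%:R `^ (g / 6) = Num.sqrt X.
    by rewrite -powR12_sqrt ?powR_ge0// /X -powRrM; congr (_ `^ _); field.
  apply: ler_wsqrtr; apply: le_trans HX; by rewrite ler_nat.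
set S := \sum_(_ <= _ < _) _ in Har *.
have S0 : 0 <= S by apply: sumr_ge0 => k _; rewrite invr_ge0.
have -> : 48 * l%:R / H%:R = 48 * (l%:R / H%:R) :> R by rewrite mulrA.
have -> : 12 * l%:R / H%:R = 12 * (l%:R / H%:R) :> R by rewrite mulrA.
move: lH; set q := l%:R / H%:R => lH.
have KY0 : 0 <= K * Y by rewrite mulr_ge0.
have s1 : S * (K * Y + 48 * q) <= 5 * Z * (K * Y + 96 * Y).
  apply: ler_pM => //; last by lra.
  by rewrite addr_ge0// mulr_ge0// divr_ge0.
have YZ : Y <= Z * Y by rewrite ler_peMl.
have KYZ : K * Y <= K * (Z * Y) by apply: ler_wpM2l.
rewrite ZY; lra.
Qed.

(** The difference of the two sequences is twice an increment of the centred
    sawtooth, plus twice an absolutely summable sequence, minus an indicator of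
    m = 0; the first part is summed by parts. *)
Lemma twisted_fibre_sum (Gam : R -> R) (GamP : gamma_like Gam) g l al ph :
  1/2 <= g < 1 -> (0 < l)%N ->
  `| \sum_(a < l.+1) (floor_fibre g a - 2 * Gam (1 + g) * binc g a) *
       cos (2 * pi * (al * a%:R + ph)) |
  <= (4 * (53 * (24 / Num.sqrt (1 - g)) + 504) + 7) * l%:R `^ (1 - g / 4).
Proof.
move=> g01 l0; have /andP[g0 g1] := g01.
have g01' : 0 < g <= 1 by lra.
set D := 53 * _ + 504; set L := l%:R `^ _.
have L1 : 1 <= L.
  by rewrite -[leLHS](powRr0 l%:R) ler_powR ?ler1n//; lra.
pose chi m : R := (ceil_pow g m)%:R - m%:R `^ g - 2^-1.
pose c m := cos (2 * pi * (al * m%:R + ph)).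
have c1 m : `|c m| <= 1 by apply: cos_max.
have chi1 m : `|chi m| <= 2^-1.
  by have /andP[h1 h2] := ceil_pow_itv g m; rewrite /chi ler_norml; apply/andP;
    split; lra.
pose T1 := \sum_(0 <= m < l.+1) (chi m.+1 - chi m) * c m.
pose T2 := \sum_(0 <= m < l.+1) ((m.+1%:R `^ g - m%:R `^ g) - Gam (1 + g)
  * binc g m) * c m.
have e : \sum_(a < l.+1) (floor_fibre g a - 2 * Gam (1 + g) * binc g a) * c a
   = 2 * T1 + 2 * T2 - c 0%N.
  rewrite -(big_mkord xpredT (fun a => (floor_fibre g a - 2 * Gam (1 + g)
    * binc g a) * c a)).
  (* The fibre of 0 carries a correction, so m = 0 is treated apart. *)
  rewrite /T1 /T2 !mulr_sumr -big_split/= big_ltn// [in RHS]big_ltn//.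
  rewrite (eq_big_nat _ _ (F2 := fun i => 2 * ((chi i.+1 - chi i) * c i) +
    2 * ((i.+1%:R `^ g - i%:R `^ g - Gam (1 + g) * binc g i) * c i))); last first.
    by move=> [//|m] _; rewrite /floor_fibre /chi /= subr0; ring.
  by rewrite /floor_fibre /chi/=; ring.
rewrite -/(c _) e.
have T2b : `|T2| <= 2.
  apply: le_trans (binc_powR_diff_sum GamP l g01').
  apply: (le_trans (ler_norm_sum _ _ _)); apply: ler_sum => m _.
  by rewrite normrM ler_piMr.
have T1e : T1 = \sum_(1 <= m < l.+1) chi m * cos (2 * pi * (al * m%:R + (ph - al)))
   - \sum_(1 <= m < l.+1) chi m * c m + (chi l.+1 * c l - chi 0%N * c 0%N).
  rewrite /T1.
  under eq_bigr do rewrite mulrBl.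
  rewrite sumrB [X in X - _ = _]big_nat_recr//= [X in _ - X = _]big_ltn//.
  rewrite [in RHS]big_add1/=.
  have -> : \sum_(0 <= i < l) chi i.+1 * cos (2 * pi * (al * i.+1%:R + (ph - al)))
     = \sum_(0 <= i < l) chi i.+1 * c i.
    by apply: eq_bigr => m _; congr (_ * cos (_ * _)); rewrite -natr1; ring.
  ring.
have b1 := @twisted_ceil_sum g l al (ph - al) g01 l0.
have b2 := @twisted_ceil_sum g l al ph g01 l0.
rewrite -/D -/L in b1 b2.
have b3 : `|chi l.+1 * c l - chi 0%N * c 0%N| <= 1.
  apply: (le_trans (ler_normB _ _)); rewrite !normrM.
  have h1 := ler_pM (normr_ge0 _) (normr_ge0 _) (chi1 l.+1) (c1 l).
  have h2 := ler_pM (normr_ge0 _) (normr_ge0 _) (chi1 0%N) (c1 0%N).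
  lra.
have T1b : `|T1| <= 2 * D * L + 1.
  rewrite T1e; apply: (le_trans (ler_normD _ _)).
  by apply: le_trans (lerD (ler_normB _ _) b3) _; lra.
have c0 := c1 0%N.
apply: (le_trans (ler_normB _ _)).
have := ler_normD (2 * T1) (2 * T2); rewrite !normrM (ger0_norm (_ : 0 <= 2))//.
lra.
Qed.

Lemma binc_sqr_sum (Gam : R -> R) (GamP : gamma_like Gam) g l :
  0 < g <= 1 -> (0 < l)%N ->
  \sum_(m < l.+1) (2 * Gam (1 + g) * binc g m) ^+ 2 <= 8 * l%:R `^ g.
Proof.
move=> g01 l0; have /andP[g0 g1] := g01.
have [G1 Gpos _ Gle] := GamP.
have Gg1 : Gam (1 + g) <= 1.
  by have := Gle 1 g ltr01 ltac:(lra); rewrite powR1 G1 mulr1.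
have Gg0 : 0 < Gam (1 + g) by apply: Gpos; lra.
have l1 : 1 <= l%:R :> R by rewrite ler1n.
apply: (@le_trans _ _ (4 * (Gam (1 + g) * \sum_(k < l.+1) binc g k))).
  rewrite !mulr_sumr; apply: ler_sum => k _.
  have r0 := @binc_ge0 R g k (ltW g0).
  have r1 := @binc_le1 R g k ltac:(lra).
  move: (Gam _) (binc g k) Gg1 Gg0 r0 r1 => G r G1' G0 r0 r1.
  have : G * r <= 1 * 1 by apply: ler_pM => //; exact: ltW.
  have Gr0 : 0 <= G * r by rewrite mulr_ge0// ltW.
  move=> Gr1; have : (G * r) * (G * r) <= 1 * (G * r) by apply: ler_pM => //; lra.
  have -> : (2 * G * r) ^+ 2 = 4 * ((G * r) * (G * r)) by ring.
  lra.
have h := @binc_sum_le R Gam GamP g l g01.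
have : l.+1%:R `^ g <= 2 * l%:R `^ g :> R.
  apply: (@le_trans _ _ ((2 * l%:R) `^ g)).
    by apply: ge0_ler_powR; rewrite ?nnegrE -?natr1//; lra.
  rewrite powRM//; apply: ler_wpM2r; first exact: powR_ge0.
  by apply: ler1_powR; lra.
lra.
Qed.

(** With g = 1/c the exponent of the error term is (6 g + 3) / 5, and the
    comparison 1 - g/4 + g <= (6 g + 3) / 5 amounts to g >= 8/9. *)
Lemma rep_count_asymptotic (Gam : R -> R) (GamP : gamma_like Gam) (c : R) :
  1 < c -> c <= 9 / 8 ->
  exists C : R, 0 < C /\ forall l : nat, (0 < l)%N ->
    `| (rep_count c l)%:R
       - 2 ^+ 3 * Gam (1 + 1 / c) ^+ 3 / Gam (3 / c) * l%:R `^ (3 / c - 1) |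
    <= C * l%:R `^ (3 / c - 1 - (9 - 8 * c) / (5 * c)).
Proof.
move=> c1 c98; pose g := c^-1.
have cp : 0 < c by lra.
have g0 : 0 < g by rewrite invr_gt0.
have g1 : g < 1 by rewrite /g invf_lt1.
have g89 : 8 / 9 <= g.
  by rewrite /g -[leLHS]invrK lef_pV2 ?posrE ?invr_gt0//; lra.
have g01 : 0 < g <= 1 by lra.
have [G1 Gpos _ Gle] := GamP.
have -> : 1 / c = g by rewrite /g div1r.
have -> : 3 / c = 3 * g by [].
have -> : 3 * g - 1 - (9 - 8 * c) / (5 * c) = (6 * g + 3) / 5.
  by rewrite /g; field; rewrite gt_eqF.
pose D := 4 * (53 * (24 / Num.sqrt (1 - g)) + 504) + 7.
have D0 : 0 <= D.
  have : 0 <= 24 / Num.sqrt (1 - g) by rewrite divr_ge0// sqrtr_ge0.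
  by rewrite /D; lra.
have G3 : 0 < Gam (3 * g) by apply: Gpos; lra.
have Gg : 0 < Gam (1 + g) by apply: Gpos; lra.
pose k := 2 * Gam (1 + g).
have k0 : 0 <= k ^+ 3 / Gam (3 * g) by rewrite divr_ge0 ?exprn_ge0 ?mulr_ge0 ?ltW.
exists (72 * D + 5 * (k ^+ 3 / Gam (3 * g)) + 1); split; first by lra.
move=> l l0.
have l1 : 1 <= l%:R :> R by rewrite ler1n.
have lp : 0 < l%:R :> R by lra.
set T := l%:R `^ ((6 * g + 3) / 5).
have T0 : 0 <= T by apply: powR_ge0.
rewrite rep_count_conv3; last exact: ltW.
rewrite -/g.
set F := floor_fibre g; pose G m := k * binc g m.
have main : `|conv3 G G G l - 2 ^+ 3 * Gam (1 + g) ^+ 3 / Gam (3 * g)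
  * l%:R `^ (3 * g - 1)|
   <= 5 * (k ^+ 3 / Gam (3 * g)) * T.
  rewrite conv3_rbin.
  have -> : 2 ^+ 3 * Gam (1 + g) ^+ 3 = k ^+ 3 by rewrite /k exprMn.
  have -> : k ^+ 3 * binc (3 * g) l - k ^+ 3 / Gam (3 * g) * l%:R `^ (3 * g - 1)
    = k ^+ 3 * (binc (3 * g) l - l%:R `^ (3 * g - 1) / Gam (3 * g)) by ring.
  have k30 : 0 <= k ^+ 3 by rewrite exprn_ge0// mulr_ge0// ltW.
  rewrite normrM ger0_norm//.
  have h := @binc_asymptotic R Gam GamP (3 * g) l ltac:(lra) l0.
  apply: (le_trans (ler_wpM2l k30 h)).
  have -> : k ^+ 3 * (5 / Gam (3 * g) * l%:R `^ (3 * g - 2)) =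
    5 * (k ^+ 3 / Gam (3 * g)) * l%:R `^ (3 * g - 2) by ring.
  apply: ler_wpM2l; first by lra.
  by rewrite /T ler_powR//; lra.
pose E m := F m - G m.
have tw al ph : `|\sum_(a < l.+1) E a * cos (2 * pi * (al * a%:R + ph))| <= D
  * l%:R `^ (1 - g / 4).
  by apply: (twisted_fibre_sum GamP) => //; lra.
have FF := @floor_fibre_sqr_sum R g l g01 l0.
have GG := @binc_sqr_sum Gam GamP g l g01 l0.
rewrite -/F in FF; rewrite -/k in GG.
set P := l%:R `^ g in FF GG.
have P0 : 0 <= P by apply: powR_ge0.
have Q0 : 0 <= D * l%:R `^ (1 - g / 4) by rewrite mulr_ge0// powR_ge0.
have step (U V : nat -> R) : \sum_(b < l.+1) U b ^+ 2 <= 12 * P -> \sum_(b <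
  l.+1) V b ^+ 2 <= 12 * P ->
   `|conv3 E U V l| <= 24 * D * (l%:R `^ (1 - g / 4) * P).
  move=> hU hV; apply: (le_trans (conv3_bound U V tw)).
  have -> : 24 * D * (l%:R `^ (1 - g / 4) * P) = D * l%:R `^ (1 - g / 4) * (12
    * P + 12 * P) by ring.
  by apply: ler_wpM2l => //; apply: lerD.
have GG' : \sum_(b < l.+1) G b ^+ 2 <= 12 * P by apply: (le_trans GG); lra.
have PT : l%:R `^ (1 - g / 4) * P <= T.
  rewrite /P -powRD; last by rewrite (gt_eqF lp) implybT.
  by rewrite /T ler_powR//; lra.
have DT : 24 * D * (l%:R `^ (1 - g / 4) * P) <= 24 * D * T.
  by apply: ler_wpM2l => //; lra.
have e1 := step F F FF FF; have e2 := step F G FF GG'; have e3 := step G G GG' GG'.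
have dec := conv3_diff F G l; rewrite -/E in dec.
have -> : conv3 F F F l - 2 ^+ 3 * Gam (1 + g) ^+ 3 / Gam (3 * g) * l%:R `^ (3
  * g - 1)
  = (conv3 F F F l - conv3 G G G l) +
    (conv3 G G G l - 2 ^+ 3 * Gam (1 + g) ^+ 3 / Gam (3 * g) * l%:R `^ (3 * g
      - 1)) by ring.
apply: (le_trans (ler_normD _ _)); rewrite dec.
have n1 := ler_normD (conv3 E F F l + conv3 E F G l) (conv3 E G G l).
have n2 := ler_normD (conv3 E F F l) (conv3 E F G l).
have s3 : `|conv3 E F F l + conv3 E F G l + conv3 E G G l| <= 72 * D * T.
  by clear -n1 n2 e1 e2 e3 DT; lra.
have -> : (72 * D + 5 * (k ^+ 3 / Gam (3 * g)) + 1) * T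
  = 72 * D * T + 5 * (k ^+ 3 / Gam (3 * g)) * T + T by ring.
apply: (le_trans (lerD s3 main)).
by rewrite lerDl.
Qed.

End Assembly.

Theorem corollary1p3 (R : realType) (c : R) (hc1 : 1 < c) (hc2 : c < 9 / 8)
    (eps : R) (heps : 0 < eps) :
  exists C : R, 0 < C /\
    forall lambda : nat, (1 <= lambda)%N ->
      `| (rep_count c lambda)%:R
         - 2 ^+ 3 * Gamma (1 + 1 / c) ^+ 3 / Gamma (3 / c)
           * lambda%:R `^ (3 / c - 1) |
      <= C * lambda%:R `^ (3 / c - 1 - (9 - 8 * c) / (5 * c) + eps).
Proof.
have [C [C0 hC]] := rep_count_asymptotic (gamma_like_Gamma R) hc1 (ltW hc2).
exists C; split => // lambda l1; apply: (le_trans (hC lambda l1)).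
rewrite ler_pM2l// ler_powR ?ler1n//.
by rewrite lerDl ltW.
Qed.
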